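(* Let $K$ be a field of characteristic $0$ and $G$ a finite abelian group. The algebra map $\Theta_G:\Sigma(G)\to\Sigma(G)$ defined on the free generators by $$\Theta_G\big(d^G_{(n)^g}\big)=2\,\mathring p^{\,G}_{(n)^g}\qquad(n\ge1,\ g\in G)$$ is a Hopf morphism. Moreover, $\Theta_G(\Sigma(G))=\mathring{\mathcal P}(G)$.
   Context: $G_n=G^n\rtimes\mathfrak S_n$ is the wreath product; its elements are written $\sigma^{\mathbf g}=\sigma\cdot(g_1,\dots,g_n)$ and identified with coloured words $\sigma(1)^{g_1}\cdots\sigma(n)^{g_n}$; multiplication is determined by $\sigma\cdot(g_1,\dots,g_n)=(g_{\sigma^{-1}(1)},\dots,g_{\sigma^{-1}(n)})\cdot\sigma$; $\mathfrak S_n\subseteq G_n$ via trivial colours. Hopf algebra $K[\mathsf G]=\bigoplus_{n\ge0}KG_n$: for $\sigma\in\mathfrak S_n$, $\tau\in\mathfrak S_m$, $\sigma\times\tau\in\mathfrak S_{n+m}$ maps $a\in[1,n]$ to $\sigma(a)$ and $n+b$ to $n+\tau(b)$; $\sigma^{\mathbf g}\times\tau^{\mathbf h}=(\sigma\times\tau)^{\mathbf g\cdot\mathbf h}$. $X_{(n,m)}$ is the set of $u\in\mathfrak S_{n+m}$ increasing on $[1,n]$ and on $[n+1,n+m]$. For $\alpha\in G_n$, $\beta\in G_m$: $\alpha*\beta=\sum_{u\in X_{(n,m)}}u(\alpha\times\beta)$. For $\alpha\in G_n$ and $i\in[0,n]$ let $\alpha_{(i)}\in G_i$, $\alpha_{(n-i)}\in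 G_{n-i}$ be the unique elements with $\alpha^{-1}=u(\alpha_{(i)}\times\alpha_{(n-i)})^{-1}$ for some $u\in X_{(i,n-i)}$; $\Delta(\alpha)=\sum_{i=0}^n\alpha_{(i)}\otimes\alpha_{(n-i)}$. With these $K[\mathsf G]$ is a graded connected Hopf algebra. The rainbow decomposition of $\sigma^{\mathbf g}$ is the unique factorization $\sigma_1^{g_1}\cdots\sigma_k^{g_k}$ of the coloured word into nonempty monochromatic words with $g_i\ne g_{i+1}$. $\mathrm{std}(w)$ for $w=a_1\cdots a_n$ is the unique $\sigma\in\mathfrak S_n$ with, for $i<j$, $\sigma(i)>\sigma(j)\iff a_i>a_j$. For $I=\{i_1<\dots<i_k\}\subseteq[1,n-1]$, $\mathbf c_I=(i_1,i_2-i_1,\dots,n-i_k)$. For $\sigma\in\mathfrak S_n$: $D(\sigma)=\mathbf c_I$ with $I=\{i\in[1,n-1]:\sigma(i)>\sigma(i+1)\}$, and $\mathring P(\sigma)=\mathbf c_I$ with $I=\{i\in[1,n-1]:i>1,\ \sigma(i-1)<\sigma(i)>\sigma(i+1)\}$; for words, $D(w)=D(\mathrm{std}(w))$, $\mathring P(w)=\mathring P(\mathrm{std}(w))$. For a composition $\mathbf c=(c_1,\dots,c_r)$ and $g\in G$, $\mathbf c^g=c_1^g\cdots c_r^g$; a $G$-composition of $n$ is a word in letters $c^g$ ($c\ge1$, $g\in G$) with integers summing to $n$. Put $D_G(\sigma^{\mathbf g})=D(\sigma_1)^{g_1}\cdots D(\sigma_k)^{g_k}$ and $\mathring P_G(\sigma^{\mathbf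 g})=\mathring P(\sigma_1)^{g_1}\cdots\mathring P(\sigma_k)^{g_k}$ (concatenations). Set $d^G_{\mathbf c^{\mathbf g}}=\sum_{D_G(\alpha)=\mathbf c^{\mathbf g}}\alpha$ and $\mathring p^{\,G}_{\mathbf c^{\mathbf g}}=\sum_{\mathring P_G(\alpha)=\mathbf c^{\mathbf g}}\alpha$. $\Sigma(G)\subseteq K[\mathsf G]$ is the graded span of all $d^G_{\mathbf c^{\mathbf g}}$ and $\mathring{\mathcal P}(G)$ the graded span of all $\mathring p^{\,G}_{\mathbf c^{\mathbf g}}$. $\Sigma(G)$ is a Hopf subalgebra of $K[\mathsf G]$, freely generated as an algebra (for $*$) by the elements $d^G_{(n)^g}$, $n\ge1$, $g\in G$ ($d^G_{(n)^g}$ is the identity permutation of $[1,n]$ with all letters coloured $g$). *)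

(* Defs.v *)
From HB Require Import structures.
From mathcomp Require Import all_boot all_algebra all_fingroup.
From mathcomp Require Import finmap monalg.

Set Implicit Arguments.
Unset Strict Implicit.
Unset Printing Implicit Defensive.

Import GRing.Theory.
Local Open Scope ring_scope.

(* MathComp composes permutations from left to right, (s * t)%g i = t (s i).
   The permutation product sigma tau of the mathematical text (first tau, then
   sigma) is therefore written (tau * sigma)%g.                              *)

Section WreathProduct.
Variable gT : finGroupType.
Local Open Scope group_scope.

(* (s, g) stands for the coloured word s(1)^{g_1} ... s(n)^{g_n}, that is for
   s . (g_1, ..., g_n).                                                      *)
Definition wreath (n : nat) : Type := ('S_n * {ffun 'I_n -> gT})%type.

HB.instance Definition _ n := Finite.on (wreath n).

(* s.(g_1..g_n) . t.(h_1..h_n) = (s t) . (g_{t(1)} h_1, ..., g_{t(n)} h_n) *)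
Definition wreath_mul n (a b : wreath n) : wreath n :=
  (b.1 * a.1, [ffun i => a.2 (b.1 i) * b.2 i]).

Definition wreath_one n : wreath n := (1, [ffun=> 1]).

Definition wreath_inv n (a : wreath n) : wreath n :=
  (a.1^-1, [ffun i => (a.2 (a.1^-1 i))^-1]).

Lemma wreath_mulA n : associative (@wreath_mul n).
Proof.
move=> a b c; congr pair; first by rewrite /= mulgA.
by apply/ffunP=> i; rewrite !ffunE /= permM mulgA.
Qed.

Lemma wreath_mul1 n : left_id (@wreath_one n) (@wreath_mul n).
Proof.
case=> s g; congr pair; first by rewrite /= mulg1.
by apply/ffunP=> i; rewrite !ffunE /= mul1g.
Qed.

Lemma wreath_mulV n :
  left_inverse (@wreath_one n) (@wreath_inv n) (@wreath_mul n).
Proof.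
case=> s g; congr pair; first by rewrite /= mulgV.
by apply/ffunP=> i; rewrite !ffunE /= permK mulVg.
Qed.

HB.instance Definition _ n := Finite_isGroup.Build (wreath n)
  (@wreath_mulA n) (@wreath_mul1 n) (@wreath_mulV n).

Definition of_perm n (s : 'S_n) : wreath n := (s, [ffun=> 1]).

Section Times.
Variables n m : nat.

Definition perm_times_fun (s : 'S_n) (t : 'S_m) (k : 'I_(n + m)) : 'I_(n + m) :=
  match split k with
  | inl a => lshift m (s a)
  | inr b => rshift n (t b)
  end.

Lemma perm_times_inj s t : injective (perm_times_fun s t).
Proof.
move=> i j; rewrite /perm_times_fun.
case: (split_ordP i) => a ->; case: (split_ordP j) => b ->.
- by move/lshift_inj/perm_inj->.
- by move/eqP; rewrite eq_lrshift.
- by move/eqP; rewrite eq_rlshift.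
- by move/rshift_inj/perm_inj->.
Qed.

Definition perm_times s t : 'S_(n + m) := perm (@perm_times_inj s t).

Definition times (a : wreath n) (b : wreath m) : wreath (n + m) :=
  (perm_times a.1 b.1,
   [ffun k => match split k with inl i => a.2 i | inr j => b.2 j end]).

End Times.

End WreathProduct.

(* The permutations of [1, n + m] increasing on [1, n] and on [n + 1, n + m]. *)
Definition X (n m : nat) : {set 'S_(n + m)} :=
  [set u : 'S_(n + m) |
    [forall i : 'I_n, forall j : 'I_n,
       (i < j)%N ==> (u (lshift m i) < u (lshift m j))%N] &&
    [forall i : 'I_m, forall j : 'I_m,
       (i < j)%N ==> (u (rshift n i) < u (rshift n j))%N]].

(* The disjoint union of the groups G_n, a basis of K[G]. *)
Definition Gpt (gT : finGroupType) : Type := {n : nat & wreath gT n}.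
HB.instance Definition _ gT := Choice.on (Gpt gT).

Notation KG K gT := {malg K[Gpt gT]}.

(* K[G] (x) K[G], as the free module on pairs of basis elements. *)
Notation KG2 K gT := {malg K[(Gpt gT * Gpt gT)%type]}.

Section Hopf.
Variables (K : fieldType) (gT : finGroupType).
Local Notation Gpt := (Gpt gT).
Local Notation KG := (KG K gT).
Local Notation KG2 := (KG2 K gT).

Definition pt n (a : wreath gT n) : Gpt := Tagged (wreath gT) a.

Definition bas n (a : wreath gT n) : KG := << pt a >>.

Definition lin_ext (T : choiceType) (V : lmodType K) (f : T -> V)
    (x : {malg K[T]}) : V :=
  \sum_(a <- msupp x) x@_a *: f a.

Definition tensor (x y : KG) : KG2 :=
  lin_ext (fun a : Gpt => lin_ext (fun b : Gpt => << (a, b) >> : KG2) y) x.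

Definition tensor_map (f g : KG -> KG) : KG2 -> KG2 :=
  lin_ext (fun ab : Gpt * Gpt =>
    tensor (f << ab.1 >>) (g << ab.2 >>)).

Definition bas_mul (a b : Gpt) : KG :=
  \sum_(u in X (tag a) (tag b))
    bas (of_perm gT u * times (tagged a) (tagged b))%g.

(* Linear extension of the product *, from K[G] (x) K[G] to K[G]. *)
Definition mul_tensor : KG2 -> KG :=
  lin_ext (fun ab : Gpt * Gpt => bas_mul ab.1 ab.2).

Definition KGmul (x y : KG) : KG := mul_tensor (tensor x y).

Definition KGone : KG := bas (1%g : wreath gT 0).

(* For each i exactly one pair (b, c) satisfies the condition, namely
   (alpha_(i), alpha_(n-i)).  The equality is between tagged elements because
   i + (n - i) and n are not convertible.                                    *)
Definition bas_coprod (a : Gpt) : KG2 :=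
  \sum_(i < (tag a).+1)
    \sum_(bc : wreath gT i * wreath gT (tag a - i) |
          [exists u in X i (tag a - i),
             pt (tagged a)^-1%g
               == pt (of_perm gT u * (times bc.1 bc.2)^-1)%g])
      << (pt bc.1, pt bc.2) >>.

Definition coprod : KG -> KG2 := lin_ext bas_coprod.

Definition counit : KG -> K :=
  lin_ext (fun a : Gpt => (tag a == 0%N)%:R : K^o).

End Hopf.

Section Statistics.

(* sigma(i), for i counted from 1 and values in [1, n]. *)
Definition value n (s : 'S_n) (i : nat) : nat :=
  nth 0%N [seq (s k).+1 | k <- enum 'I_n] i.-1.

(* c_I, for I the increasing list of elements of a subset of [1, n - 1]. *)
Definition comp_of_set (n : nat) (I : seq nat) : seq nat :=
  pairmap (fun i j => j - i)%N 0%N (rcons I n).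

Definition Des n (s : 'S_n) : seq nat :=
  comp_of_set n [seq i <- iota 1 n.-1 | (value s i.+1 < value s i)%N].

Definition Peak n (s : 'S_n) : seq nat :=
  comp_of_set n [seq i <- iota 1 n.-1 |
    [&& 1 < i, value s i.-1 < value s i & value s i.+1 < value s i]%N].

(* Exactly one permutation satisfies the condition: the default is not used. *)
Definition std (w : seq nat) : 'S_(size w) :=
  odflt 1%g [pick s : 'S_(size w) |
    [forall i : 'I_(size w), forall j : 'I_(size w),
       (i < j)%N ==> ((s j < s i)%N == (nth 0%N w j < nth 0%N w i)%N)]].

Definition Des_word (w : seq nat) : seq nat := Des (std w).
Definition Peak_word (w : seq nat) : seq nat := Peak (std w).

End Statistics.

Section Coloured.
Variable gT : finGroupType.

Definition coloured_word n (a : wreath gT n) : seq (nat * gT) :=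
  [seq ((a.1 k).+1, a.2 k) | k <- enum 'I_n].

(* The maximal monochromatic factors of a coloured word, with their colours. *)
Fixpoint rainbow (w : seq (nat * gT)) : seq (seq nat * gT) :=
  if w is (a, g) :: w' then
    match rainbow w' with
    | (v, h) :: r => if g == h then (a :: v, g) :: r
                     else ([:: a], g) :: (v, h) :: r
    | [::] => [:: ([:: a], g)]
    end
  else [::].

Definition rainbow_lift (f : seq nat -> seq nat) n (a : wreath gT n) :
    seq (nat * gT) :=
  flatten [seq [seq (c, vg.2) | c <- f vg.1] | vg <- rainbow (coloured_word a)].

Definition DesG n (a : wreath gT n) := rainbow_lift Des_word a.
Definition PeakG n (a : wreath gT n) := rainbow_lift Peak_word a.

(* The letter c^g is the pair (c, g). *)
Definition is_Gcomp (c : seq (nat * gT)) : bool := all (fun p => 0 < p.1)%N c.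

Definition weight (c : seq (nat * gT)) : nat := sumn (unzip1 c).

Variable K : fieldType.

Definition dG (c : seq (nat * gT)) : KG K gT :=
  \sum_(a : wreath gT (weight c) | DesG a == c) bas K a.

Definition pG (c : seq (nat * gT)) : KG K gT :=
  \sum_(a : wreath gT (weight c) | PeakG a == c) bas K a.

Definition in_span (v : seq (nat * gT) -> KG K gT) (x : KG K gT) : Prop :=
  exists2 s : seq (K * seq (nat * gT)),
    all (fun p => is_Gcomp p.2) s & x = \sum_(p <- s) p.1 *: v p.2.

Definition Sigma : KG K gT -> Prop := in_span dG.
Definition Peaks : KG K gT -> Prop := in_span pG.

End Coloured.

(* A linear map defined on a subspace H of K[G] is represented by a linear
   endomorphism of K[G], of which only the restriction to H matters. For H a
   subcoalgebra, f (x) f below is only evaluated on H (x) H.                 *)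
Section Morphisms.
Variables (K : fieldType) (gT : finGroupType).
Implicit Types (H : KG K gT -> Prop) (f S : {linear KG K gT -> KG K gT}).

Definition maps_into H f : Prop := forall x, H x -> H (f x).

Definition algebra_map_on H f : Prop :=
  f (KGone K gT) = KGone K gT /\
  (forall x y, H x -> H y -> f (KGmul x y) = KGmul (f x) (f y)).

Definition coalgebra_map_on H f : Prop :=
  (forall x, H x -> coprod (f x) = tensor_map f f (coprod x)) /\
  (forall x, H x -> counit (f x) = counit x).

Definition antipode_on H S : Prop :=
  maps_into H S /\
  (forall x, H x ->
     mul_tensor (tensor_map S idfun (coprod x)) = counit x *: KGone K gT /\
     mul_tensor (tensor_map idfun S (coprod x)) = counit x *: KGone K gT).

Definition hopf_morphism_on H f : Prop :=
  [/\ maps_into H f, algebra_map_on H f, coalgebra_map_on H f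
    & forall S, antipode_on H S -> forall x, H x -> f (S x) = S (f x)].

Definition is_Theta f : Prop :=
  [/\ maps_into (@Sigma gT K) f, algebra_map_on (@Sigma gT K) f
    & forall (n : nat) (g : gT), (0 < n)%N ->
        f (dG K [:: (n, g)]) = 2 *: pG K [:: (n, g)]].

End Morphisms.

(* Main.v *)
Require Import Defs.
From HB Require Import structures.
From mathcomp Require Import all_boot all_algebra all_fingroup.
From mathcomp Require Import finmap monalg.
From mathcomp Require Import zify ring.
Import GRing.Theory.
Local Open Scope ring_scope.

Set Implicit Arguments.
Unset Strict Implicit.
Unset Printing Implicit Defensive.

(** Why the theorem holds.

    Elements of K[G] are described by coefficient functions on coloured words.
    If F and F' depend only on colours and relative order, the product of the
    sums of F(u) u and F'(u) u, over the words of sizes n and m, has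
    F(u) F'(u') as coefficient of the word u u' (KGmul_word_sum), because
    u (alpha x beta) runs once over the words whose factors standardize to
    alpha and beta.  Dually, the coefficient of beta (x) gamma in the coproduct
    is the sum of F over the shuffles of beta with the shifted gamma
    (coprod_word_sum).

    Deconcatenation is a morphism for shuffles (big_cuts_shuffles).  So, if phi
    is multiplicative on shuffles of a low word with a high word, the
    homogeneous components of the sum of phi(w) w form a divided power
    sequence, and the coproduct of a product of such components is the sum over
    all ways to split every degree in two (coprod_block_sum).  The indicators
    of increasing and of decreasing words are such characters, hence so is
    their convolution veeK.  The former gives the generators d_(n)^g.  The
    latter counts the cuts of a word into a decreasing and an increasing part,
    which is 2 for a word without interior peak and 0 otherwise (veeK_vee): it
    gives 2 p_(n)^g.  Therefore the products hprod v of generators and the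
    products vprod v of their images satisfy the same multiplication rule and
    the same coproduct formula.  A linear map that sends hprod v to vprod v is
    an algebra and a coalgebra map, and it commutes with antipodes because
    convolution inverses are unique (f_antipode).

    Such a map exists because
    d_(n)^g * d_c = d_((n, g) :: c) + (the term where n merges with the first
    part of c, when it has colour g)
    (hprod_mul_dG).  Read from right to left, this rule defines the image of
    every d_c; the d_c are sums over disjoint nonempty sets of permutations, so
    the images can be prescribed at will, and the rule then gives the products
    of generators the right images (theta_hprod).  The same rule shows that
    these products span Sigma(G) (Sigma_ind), whence uniqueness.

    The coefficient of w in vprod v is nonzero exactly when w has the colours of
    v and no interior peak inside a block of v.  This depends only on the peak
    composition of w, so the image is contained in the span of the peak
    classes.  Conversely, take for v the peak composition of a word w0, with
    set of breaks P.  The words that occur have their breaks in the union of P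
    and P + 1, and their peaks are pairwise nonadjacent.  Weighting a break by
    its distance to the end, such a set is lighter than P or equal to P
    (peak_coef_triangular).  So the transition from peak classes to products is
    triangular with nonzero diagonal entries, and every peak class sum is in
    the image (class_sum_peaks). *)

(** * Cutting and shuffling words *)

Section CutsShuffles.
Variable T : Type.

(** The terms of the deconcatenation coproduct of a word. *)
Fixpoint cuts (w : seq T) : seq (seq T * seq T) :=
  ([::], w) ::
  if w is a :: w' then [seq (a :: p.1, p.2) | p <- cuts w'] else [::].

Fixpoint shuffles (x : seq T) : seq T -> seq (seq T) :=
  if x is a :: x' then
    fix shuffles_x (y : seq T) :=
      if y is b :: y' then
        [seq a :: w | w <- shuffles x' y] ++ [seq b :: w | w <- shuffles_x y']
      else [:: x]
  else fun y => [:: y].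

Lemma cuts0 : cuts [::] = [:: ([::], [::])].
Proof. by []. Qed.

Lemma cuts_cons a w :
  cuts (a :: w) = ([::], a :: w) :: [seq (a :: p.1, p.2) | p <- cuts w].
Proof. by []. Qed.

Lemma shuffles0 x : shuffles x [::] = [:: x].
Proof. by case: x. Qed.

Lemma shuffles_cons a x b y :
  shuffles (a :: x) (b :: y) =
    [seq a :: w | w <- shuffles x (b :: y)] ++ [seq b :: w | w <- shuffles (a ::
      x) y].
Proof. by []. Qed.

Lemma big_cuts_cons (V : nmodType) (F : seq T -> seq T -> V) a w :
  \sum_(p <- cuts (a :: w)) F p.1 p.2 =
  F [::] (a :: w) + \sum_(p <- cuts w) F (a :: p.1) p.2.
Proof. by rewrite cuts_cons big_cons big_map. Qed.

(** Deconcatenation is a morphism for the shuffle product: to cut a shuffle of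
    x and y is to cut x and y and to shuffle the left parts together and the
    right parts together.  The first letters of both words are followed
    through the two recursions; the four groups of summands that arise on each
    side match one by one. *)
Lemma big_cuts_shuffles (V : nmodType) (F : seq T -> seq T -> V) x y :
  \sum_(w <- shuffles x y) \sum_(p <- cuts w) F p.1 p.2 =
  \sum_(p <- cuts x) \sum_(q <- cuts y)
    \sum_(w1 <- shuffles p.1 q.1) \sum_(w2 <- shuffles p.2 q.2) F w1 w2.
Proof.
elim: x F y => [|a x IHx] F y.
  rewrite !big_seq1 /=; apply: eq_bigr => p _; by rewrite !big_seq1.
elim: y F => [|b y IHy] F.
  rewrite shuffles0 !big_seq1; apply: eq_bigr => p _.
  by rewrite !big_seq1 !shuffles0 !big_seq1.
rewrite shuffles_cons big_cat !big_map /=.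
under eq_bigr do rewrite big_cuts_cons.
rewrite big_split (IHx (fun w1 w2 => F (a :: w1) w2)) /=.
under [X in _ + X]eq_bigr do rewrite big_cuts_cons.
rewrite big_split (IHy (fun w1 w2 => F (b :: w1) w2)) /=.
pose G x1 x2 y1 y2 := \sum_(w1 <- shuffles x1 y1) \sum_(w2 <- shuffles x2 y2) F
  w1 w2.
(* G and H name the inner sums of the right-hand side, so that the rule for
   the first letter applies to them as functions of a cut. *)
pose H x1 x2 := \sum_(q <- cuts (b :: y)) G x1 x2 q.1 q.2.
rewrite -[RHS]/(\sum_(p <- cuts (a :: x)) H p.1 p.2) (big_cuts_cons H).
under [X in _ = _ + X]eq_bigr => p _ do
  rewrite /H (big_cuts_cons (G (a :: p.1) p.2)).
rewrite big_split /= {1}/H (big_cuts_cons (G _ _)).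
under [X in _ = _ + (_ + X)]eq_bigr => p _.
  under eq_bigr => q _ do rewrite /G /= big_cat !big_map /=.
  rewrite big_split; over.
rewrite big_split /=.
under [X in _ + X + _ = _]eq_bigr => p _.
  rewrite (big_cuts_cons (fun y1 y2 => \sum_(w1 <- shuffles p.1 y1)
    \sum_(w2 <- shuffles p.2 y2) F (a :: w1) w2)); over.
rewrite big_split /= big_cons big_map /=.
have -> : G [::] (a :: x) [::] (b :: y) =
    \sum_(w <- shuffles x (b :: y)) F [::] (a :: w)
    + \sum_(w <- shuffles (a :: x) y) F [::] (b :: w).
  by rewrite /G big_seq1 /= big_cat !big_map.
have -> : \sum_(p <- cuts y) G [::] (a :: x) (b :: p.1) p.2 =
    \sum_(q <- cuts y) \sum_(w1 <- [:: q.1])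
      \sum_(w2 <- shuffles (a :: x) q.2) F (b :: w1) w2.
  by apply: eq_bigr => q _; rewrite /G !big_seq1.
have -> : \sum_(i <- cuts x) G (a :: i.1) i.2 [::] (b :: y) =
    \sum_(i <- cuts x) \sum_(w1 <- shuffles i.1 [::])
      \sum_(w2 <- shuffles i.2 (b :: y)) F (a :: w1) w2.
  by apply: eq_bigr => q _; rewrite /G !shuffles0 !big_seq1.
by rewrite addrACA -[RHS]addrA; congr (_ + _); rewrite [LHS]addrCA -addrA.
Qed.
End CutsShuffles.
Arguments shuffles : simpl never.
Arguments cuts : simpl never.

Section CutsEq.
Variable T : eqType.
Implicit Types x y w : seq T.

Lemma mem_cuts w p : (p \in cuts w) = (p.1 ++ p.2 == w).
Proof.
elim: w p => [|a w IHw] [w1 w2]; rewrite ?cuts0 ?cuts_cons inE /=.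
  by case: w1 => [|b w1]; case: w2.
case: w1 => [|b w1] /=.
  rewrite xpair_eqE eqxx /=; case: eqP => //= _.
  by apply/negbTE/mapP=> -[].
rewrite eqseq_cons -(IHw (w1, w2)).
apply/mapP/andP => [[[u1 u2] Hu [-> -> ->]] //|[/eqP-> Hw]].
by exists (w1, w2).
Qed.

Lemma perm_shuffles x y w :
  w \in shuffles x y -> perm_eq w (x ++ y).
Proof.
elim: x y w => [|a x IHx] y w; first by rewrite inE => /eqP->.
elim: y w => [|b y IHy] w; first by rewrite shuffles0 inE cats0 => /eqP->.
rewrite shuffles_cons mem_cat => /orP[] /mapP[u us ->].
  by rewrite /= perm_cons IHx.
apply: (@perm_trans _ (b :: ((a :: x) ++ y))); first by rewrite perm_cons IHy.
by rewrite perm_sym -(cat1s b y) perm_catCA.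
Qed.

Lemma size_shuffles x y w : w \in shuffles x y -> size w = (size x + size y)%N.
Proof. by move/perm_shuffles/perm_size->; rewrite size_cat. Qed.

Lemma uniq_cuts w : uniq (cuts w).
Proof.
elim: w => [|a w IHw] //; rewrite cuts_cons cons_uniq map_inj_uniq ?IHw ?andbT.
  by apply/mapP=> -[].
by move=> [? ?] [? ?] [-> ->].
Qed.

Lemma big_cuts_size (V : nmodType) (F : seq T -> seq T -> V) n w :
  (n <= size w)%N ->
  \sum_(p <- cuts w | size p.1 == n) F p.1 p.2 = F (take n w) (drop n w).
Proof.
move=> len; rewrite big_mkcond (bigD1_seq (take n w, drop n w)) ?uniq_cuts //=.
  rewrite size_takel // eqxx big1_seq ?addr0 // => -[w1 w2] /=.
  case/andP=> neq /[!mem_cuts] /= /eqP Ew; case: eqP => // En.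
  by case/eqP: neq; rewrite -En -Ew take_size_cat // drop_size_cat.
by rewrite mem_cuts cat_take_drop.
Qed.

(** When a predicate separates the letters of x from those of y, a shuffle is
    recognised by its two subwords.  This turns shuffles into the restrictions
    of a word to its low and its high letters. *)
Lemma mem_shuffles (P : pred T) x y w :
  all P x -> all (predC P) y ->
  (w \in shuffles x y) = (filter P w == x) && (filter (predC P) w == y).
Proof.
elim: w x y => [|c w IHw] x y.
  case: x => [|a x]; case: y => [|b y] //= _ _.
  by rewrite shuffles_cons mem_cat; apply/negP => /orP[] /mapP[].
case: x => [|a x].
  move=> _ Py; rewrite inE /=; case Pc: (P c) => /=.
    apply/negbTE/eqP => E; move: Py; rewrite -E /= Pc //.
  rewrite eq_sym; case: y Py => [|b y] /=; first by rewrite andbF.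
  case/andP=> Pb Py; rewrite !eqseq_cons.
  have := IHw [::] y isT Py; rewrite inE => E.
  by rewrite [b == c]eq_sym [y == w]eq_sym E andbCA.
case: y => [|b y].
  move=> Px _; rewrite shuffles0 inE /=; case Pc: (P c) => /=; last first.
    rewrite andbF; apply/negbTE/eqP => E.
    by move: Px; rewrite -E /= Pc.
  move: Px => /= /andP[_ Px].
  have := IHw x [::] Px isT; rewrite shuffles0 inE => E.
  by rewrite !eqseq_cons E andbA.
move=> /= /andP[Pa Px] /andP[/= Pb Py].
rewrite shuffles_cons mem_cat.
have mem_cons d (s : seq (seq T)) :
    (c :: w \in [seq d :: w' | w' <- s]) = (c == d) && (w \in s).
  by apply/mapP/andP => [[u us [-> ->]]|[/eqP-> ws]]; [rewrite eqxx | exists w].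
rewrite !mem_cons !IHw //= ?Pa ?Px ?Pb ?Py //.
case Pc: (P c) => /=; rewrite ?eqseq_cons -?andbA.
  by have /negbTE-> : c != b; [apply: contraNneq Pb => <- | rewrite orbF].
have /negbTE-> /= : c != a by apply/eqP => E; rewrite -E Pc in Pa.
by rewrite andbCA.
Qed.

Lemma uniq_shuffles (P : pred T) x y :
  all P x -> all (predC P) y -> uniq (shuffles x y).
Proof.
elim: x y => [|a x IHx] // y; elim: y => [|b y IHy] //.
move=> /= /andP[Pa Px] /andP[/= Pb Py]; rewrite shuffles_cons cat_uniq.
rewrite !map_inj_uniq; try by move=> ? ? [].
rewrite IHx /= ?Pb // IHy /= ?Pa // andbT; apply/hasPn => w /mapP[u _ ->].
by apply/mapP => -[u' _ [E _]]; rewrite E Pa in Pb.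
Qed.

End CutsEq.

Section Characters.
Variables (K : fieldType) (gT : finGroupType).
Local Notation word := (seq (nat * gT)).
Implicit Types (x y w : word) (v : seq (nat * gT)) (f : word -> K) (g : gT).

Lemma weight_cons n g v : weight ((n, g) :: v) = (n + weight v)%N.
Proof. by []. Qed.

Definition below x y := allrel (fun a b : nat * gT => a.1 < b.1)%N x y.

(** A character of the shuffle algebra, except that only shuffles of a low word
    with a high word are considered: being increasing or decreasing is
    multiplicative for these only. *)
Definition shuffle_char f :=
  f [::] = 1 /\
  forall x y, below x y -> \sum_(w <- shuffles x y) f w = f x * f y.

(** The convolution product dual to deconcatenation. *)
Definition conv f f' w := \sum_(p <- cuts w) f p.1 * f' p.2.

Lemma below_cuts x y p q : below x y -> p \in cuts x -> q \in cuts y ->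
  below p.1 q.1 /\ below p.2 q.2.
Proof.
rewrite !mem_cuts => xy /eqP Ex /eqP Ey; move: xy; rewrite -Ex -Ey.
by rewrite /below allrel_catl !allrel_catr => /andP[/andP[-> _] /andP[_ ->]].
Qed.

(** Characters convolve to characters because deconcatenation is a morphism for
    the shuffle product. *)
Lemma conv_char f f' : shuffle_char f -> shuffle_char f' ->
  shuffle_char (conv f f').
Proof.
move=> [f0 fM] [f'0 f'M]; split; first by rewrite /conv big_seq1 f0 f'0 mulr1.
move=> x y xy; rewrite /conv (big_cuts_shuffles (fun w1 w2 => f w1 * f' w2)).
rewrite big_distrl /= big_seq [RHS]big_seq; apply: eq_bigr => p px.
rewrite big_distrr /= big_seq [RHS]big_seq; apply: eq_bigr => q qy.
have [b1 b2] := below_cuts xy px qy.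
by rewrite mulrACA -fM // -f'M // big_distrlr.
Qed.

Variable phi : gT -> word -> K.

(** The coefficient of w in the product, over the letters (n, g) of v, of the
    sums of (phi g u) u over the words u of size n.  Cutting w in all possible
    ways, rather than at the prescribed sizes, makes the coefficient vanish
    when w does not have the size prescribed by v. *)
Fixpoint block_coef v w : K :=
  if v is (n, g) :: v' then
    \sum_(p <- cuts w) (size p.1 == n)%:R * phi g p.1 * block_coef v' p.2
  else (w == [::])%:R.

Lemma block_coef_cons n g v w :
  block_coef ((n, g) :: v) w =
  \sum_(p <- cuts w) (size p.1 == n)%:R * phi g p.1 * block_coef v p.2.
Proof. by []. Qed.

Lemma block_coef_take n g v w : (n <= size w)%N ->
  block_coef ((n, g) :: v) w = phi g (take n w) * block_coef v (drop n w).
Proof.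
move=> len /=;
  rewrite -(big_cuts_size (fun w1 w2 => phi g w1 * block_coef v w2)) //.
rewrite [RHS]big_mkcond; apply: eq_bigr => p _.
by case: eqP; rewrite ?mul1r // !mul0r.
Qed.

Lemma block_coef_size v w : size w != weight v -> block_coef v w = 0.
Proof.
elim: v w => [|[n g] v IHv] w /=; first by case: w.
move=> neq; rewrite big_seq big1 // => p; rewrite mem_cuts => /eqP E.
case: eqP => En; last by rewrite !mul0r.
rewrite IHv ?mulr0 //; apply: contraNneq neq => E2.
by rewrite -E size_cat En E2.
Qed.

Lemma block_coef_cat v1 v2 w : size w = (weight v1 + weight v2)%N ->
  block_coef (v1 ++ v2) w
  = block_coef v1 (take (weight v1) w) * block_coef v2 (drop (weight v1) w).
Proof.
elim: v1 w => [|[n g] v IHv] w Ew.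
  by rewrite take0 drop0 /= mul1r.
move: Ew; rewrite weight_cons => Ew.
rewrite cat_cons block_coef_take; last by lia.
rewrite block_coef_take; last by rewrite size_takel; lia.
rewrite IHv ?size_drop; last lia.
by rewrite take_takel ?leq_addr // take_drop drop_drop [(weight v +
  n)%N]addnC mulrA.
Qed.

(** The index set of the coproduct of a product of blocks: each block size is
    written as a sum of two integers. *)
Fixpoint splits v : seq (seq (nat * gT) * seq (nat * gT)) :=
  if v is (n, g) :: v' then
    [seq ((i, g) :: p.1, ((n - i)%N, g) :: p.2) | i <- iota 0 n.+1, p <- splits v']
  else [:: ([::], [::])].

Lemma splits_cons n g v :
  splits ((n, g) :: v) = [seq ((i, g) :: p.1, ((n - i)%N, g) :: p.2)
                         | i <- iota 0 n.+1, p <- splits v].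
Proof. by []. Qed.

Lemma big_splits_cons (V : nmodType) (F : _ -> _ -> V) n g v :
  \sum_(p <- splits ((n, g) :: v)) F p.1 p.2 =
  \sum_(i < n.+1) \sum_(p <- splits v)
     F ((i : nat, g) :: p.1) (((n - i)%N, g) :: p.2).
Proof.
rewrite splits_cons big_allpairs_dep -(big_mkord xpredT (fun i =>
  \sum_(p <- splits v) F ((i, g) :: p.1) (((n - i)%N, g) :: p.2))).
by rewrite /index_iota subn0.
Qed.

Lemma weight_splits v p : p \in splits v ->
  (weight p.1 + weight p.2)%N = weight v.
Proof.
elim: v p => [|[n g] v IHv] p; first by rewrite inE => /eqP->.
case/allpairsPdep=> i [q [+ /IHv E ->]];
  rewrite mem_iota [_.1]/= [_.2]/= !weight_cons -E.
by rewrite add0n ltnS => le_in; rewrite addnACA subnKC.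
Qed.

Hypothesis phiC : forall g, shuffle_char (phi g).

(** The heart of the coproduct formula.  A block of a shuffle of x and y is a
    shuffle of a factor of x and a factor of y, on which the character phi g
    is multiplicative; the sizes of the two factors are the two parts in which
    the size of the block is split. *)
Lemma block_coef_shuffles v x y : below x y ->
  \sum_(w <- shuffles x y) block_coef v w =
  \sum_(p <- splits v) block_coef p.1 x * block_coef p.2 y.
Proof.
elim: v x y => [|[n g] v IHv] x y xy.
  rewrite big_seq1 /=; case: x {xy} => [|a x]; first by rewrite big_seq1 mul1r.
  rewrite mul0r big1_seq // => w /=; case: y => [|b y].
    by rewrite shuffles0 inE => /eqP->.
  by rewrite shuffles_cons mem_cat => /orP[] /mapP[? _ ->].
rewrite (big_splits_cons (fun v1 v2 => block_coef v1 x * block_coef v2 y)).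
under eq_bigr do rewrite block_coef_cons.
rewrite (big_cuts_shuffles (fun w1 w2 =>
  (size w1 == n)%:R * phi g w1 * block_coef v w2)).
under [RHS]eq_bigr => i _ do (under eq_bigr => p _ do
  rewrite !block_coef_cons big_distrlr /=).
under [RHS]eq_bigr => i _ do rewrite exchange_big /=.
rewrite [RHS]exchange_big big_seq [RHS]big_seq /=; apply: eq_bigr => p px.
under [RHS]eq_bigr => i _ do rewrite exchange_big /=.
rewrite [RHS]exchange_big big_seq [RHS]big_seq /=; apply: eq_bigr => q qy.
have [b1 b2] := below_cuts xy px qy.
transitivity ((size p.1 + size q.1 == n)%:R * (phi g p.1 * phi g q.1) *
   \sum_(p' <- splits v) block_coef p'.1 p.2 * block_coef p'.2 q.2).
  rewrite -IHv // -(phiC g).2 // -mulrA big_distrlr [RHS]big_distrr /=.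
  rewrite big_seq [RHS]big_seq; apply: eq_bigr => w1 w1s.
  by rewrite big_distrr /=; apply: eq_bigr => w2 _;
    rewrite (size_shuffles w1s) mulrA.
rewrite big_distrr [RHS]exchange_big; apply: eq_bigr => s _ /=.
have [le|gt] := leqP (size p.1) n; last first.
  have /negbTE-> : (size p.1 + size q.1 != n)%N by lia.
  rewrite !mul0r big1 // => i _.
  by have /negbTE-> : (size p.1 != i)%N; [have := ltn_ord i; lia | rewrite !mul0r].
rewrite (bigD1 (Ordinal (le : (size p.1 < n.+1)%N))) //= eqxx big1 ?addr0;
  last first.
  move=> i; rewrite -val_eqE /= eq_sym => /negbTE->; by rewrite !mul0r.
rewrite !mul1r;
  have -> : (size q.1 == n - size p.1)%N = (size p.1 + size q.1 == n)%N.
  by apply/eqP/eqP; lia.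
by case: eqP => _; rewrite ?mul1r ?mul0r ?mulr0 // mulrACA.
Qed.

End Characters.

(** * Increasing, decreasing and V-shaped words *)

Section Patterns.
Variables (K : fieldType) (gT : finGroupType).
Local Notation word := (seq (nat * gT)).
Implicit Types (x y w : word) (v : seq (nat * gT)) (g : gT).

Definition relabel (f : nat -> nat) w := [seq (f a.1, a.2) | a <- w].

(** Invariance under standardization: the value depends only on the colours and
    on the relative order of the letters. *)
Definition order_inv (T : Type) (F : word -> T) :=
  forall f w, {in unzip1 w &, {mono f : x y / (x < y)%N}} ->
    F (relabel f w) = F w.

Lemma cuts_relabel f w :
  cuts (relabel f w) = [seq (relabel f p.1, relabel f p.2) | p <- cuts w].
Proof.
elim: w => [|a w IHw] //=.
by rewrite !cuts_cons IHw /= -!map_comp.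
Qed.

Lemma cuts_mono f w p : p \in cuts w ->
  {in unzip1 w &, {mono f : x y / (x < y)%N}} ->
  {in unzip1 p.1 &, {mono f : x y / (x < y)%N}} /\
  {in unzip1 p.2 &, {mono f : x y / (x < y)%N}}.
Proof.
rewrite mem_cuts => /eqP<-; rewrite /unzip1 map_cat => fM.
by split=> x y xp yp; apply: fM; rewrite mem_cat ?xp ?yp ?orbT.
Qed.

Lemma conv_inv (F F' : word -> K) :
  order_inv F -> order_inv F' -> order_inv (conv F F').
Proof.
move=> FI FI' f w fM; rewrite /conv cuts_relabel big_map big_seq [RHS]big_seq.
by apply: eq_bigr => p pw; have [f1 f2] := cuts_mono pw fM; rewrite /= FI ?FI'.
Qed.

Lemma block_coef_inv (phi : gT -> word -> K) v :
  (forall g, order_inv (phi g)) -> order_inv (block_coef phi v).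
Proof.
move=> phiI; elim: v => [|[n g] v IHv] f w fM; first by case: w {fM}.
rewrite !block_coef_cons cuts_relabel big_map big_seq [RHS]big_seq.
apply: eq_bigr => p pw; have [f1 f2] := cuts_mono pw fM.
by rewrite /= phiI ?IHv // size_map.
Qed.

(** Increasing is meant weakly and decreasing strictly, so that consecutive
    letters always satisfy exactly one of the two conditions. *)
Fixpoint inc g w : bool :=
  if w is a :: w' then
    [&& a.2 == g, all (fun b => a.1 <= b.1)%N w' & inc g w']
  else true.

Fixpoint dec g w : bool :=
  if w is a :: w' then
    [&& a.2 == g, all (fun b => b.1 < a.1)%N w' & dec g w']
  else true.

Definition incK g w : K := (inc g w)%:R.
Definition decK g w : K := (dec g w)%:R.
(** Summing over the cuts of a word into a decreasing and an increasing part
    counts the words of V shape twice: the smallest letter may belong to either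
    part.  As a convolution of characters this is a character. *)
Definition veeK g : word -> K := conv (decK g) (incK g).

Lemma mono_cons (f : nat -> nat) (a : nat * gT) w :
  {in unzip1 (a :: w) &, {mono f : x y / (x < y)%N}} ->
  {in unzip1 w &, {mono f : x y / (x < y)%N}} /\
  {in w, forall b, (f a.1 < f b.1)%N = (a.1 < b.1)%N
                   /\ (f b.1 < f a.1)%N = (b.1 < a.1)%N}.
Proof.
move=> fM; split=> [x y xw yw|b bw].
  by apply: fM; rewrite inE ?xw ?yw orbT.
have aw : a.1 \in unzip1 (a :: w) by rewrite inE eqxx.
have bw' : b.1 \in unzip1 (a :: w) by rewrite inE map_f ?orbT.
by rewrite !fM.
Qed.

Lemma inc_inv g : order_inv (inc g).
Proof.
move=> f; elim=> [|a w IHw] // /mono_cons[fM fa] /=.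
rewrite IHw //; congr [&& _, _ & _]; rewrite all_map.
by apply: eq_in_all => b /fa[_ E] /=; rewrite leqNgt E -leqNgt.
Qed.

Lemma dec_inv g : order_inv (dec g).
Proof.
move=> f; elim=> [|a w IHw] // /mono_cons[fM fa] /=.
rewrite IHw //; congr [&& _, _ & _]; rewrite all_map.
by apply: eq_in_all => b /fa[_ E] /=.
Qed.

Lemma incK_inv g : order_inv (incK g).
Proof. by move=> f w fM; rewrite /incK inc_inv. Qed.

Lemma veeK_inv g : order_inv (veeK g).
Proof.
by apply: conv_inv => f w fM; rewrite /incK /decK ?inc_inv ?dec_inv.
Qed.

(** A shuffle of a low word with a high word is increasing only if all the low
    letters come first. *)
Lemma incK_char g : shuffle_char (incK g).
Proof.
split=> //; elim=> [|a x IHx] y; first by rewrite big_seq1 mul1r.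
case: y => [|b y] xy; first by rewrite shuffles0 big_seq1 mulr1.
have ab : (a.1 < b.1)%N by move: xy => /andP[/andP[]].
have ay : all (fun c => a.1 < c.1)%N (b :: y) by case/andP: xy.
have xy' : below x (b :: y) by case/andP: xy.
rewrite shuffles_cons big_cat !big_map /= [X in _ + X]big1_seq ?addr0; last first.
  move=> w /= /perm_shuffles/perm_mem/(_ a); rewrite inE eqxx => aw.
  rewrite /incK /=; case: allP => [/(_ a aw)|]; last by rewrite andbF.
  by rewrite leqNgt ab.
transitivity (\sum_(w <- shuffles x (b :: y))
   ((a.2 == g) && all (fun c => a.1 <= c.1)%N x)%:R * incK g w).
  rewrite big_seq [RHS]big_seq; apply: eq_bigr => w /perm_shuffles pw.
  rewrite /incK /= (perm_all _ pw) all_cat [all _ (b :: y)](_ : _ = true).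
    by rewrite andbT -natrM mulnb andbA.
  by apply: sub_all ay => c /ltnW.
rewrite -big_distrr /= IHx // mulrA; congr (_ * _).
by rewrite /incK /= -natrM mulnb andbA.
Qed.

(** A shuffle of a low word with a high word is decreasing only if all the high
    letters come first. *)
Lemma decK_char g : shuffle_char (decK g).
Proof.
split=> // x y; elim: y x => [|b y IHy] x;
  first by rewrite shuffles0 big_seq1 mulr1.
case: x => [|a x] xy; first by rewrite big_seq1 mul1r.
move: (xy); rewrite /below allrel_consr => /andP[xb xy'].
have ab : (a.1 < b.1)%N by move: xb => /andP[].
rewrite shuffles_cons big_cat !big_map /= big1_seq ?add0r; last first.
  move=> w /= /perm_shuffles/perm_mem/(_ b); rewrite mem_cat inE eqxx orbT => bw.
  rewrite /decK /=; case: allP => [/(_ b bw)|]; last by rewrite andbF.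
  by rewrite ltnNge ltnW.
transitivity (\sum_(w <- shuffles (a :: x) y)
   ((b.2 == g) && all (fun c => c.1 < b.1)%N y)%:R * decK g w).
  rewrite big_seq [RHS]big_seq; apply: eq_bigr => w /perm_shuffles pw.
  rewrite /decK /= (perm_all _ pw) all_cat xb /=.
  by rewrite -natrM mulnb andbA.
rewrite -big_distrr /= IHy // mulrCA; congr (_ * _).
by rewrite /decK /= -natrM mulnb andbA.
Qed.

Lemma veeK_char g : shuffle_char (veeK g).
Proof. exact: conv_char (decK_char g) (incK_char g). Qed.

(** Words of V shape: a decreasing word followed by an increasing one. *)
Fixpoint vee g w : bool :=
  if w is a :: w' then
    (a.2 == g) &&
    (if w' is b :: _ then if (b.1 < a.1)%N then vee g w' else inc g w' else true)
  else true.

(** By recursion on the word.  If it starts with a descent, the first letter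
    must be in the decreasing part, and the cuts are those of the rest.  If it
    starts with an ascent, only the first letter can be in the decreasing part,
    and it may be put in either part. *)
Lemma veeK_vee g a w : veeK g (a :: w) = 2 * (vee g (a :: w))%:R.
Proof.
elim: w a => [|b w IHw] a.
  rewrite /veeK /conv !cuts_cons cuts0 /= !big_cons big_nil /decK /incK /=.
  by rewrite !andbT; case: (_ == _); rewrite /=; ring.
rewrite /veeK /conv (big_cuts_cons (fun x y => decK g x * incK g y)).
rewrite (big_cuts_cons (fun x y => decK g (a :: x) * incK g y)).
have [ba|ab] := ltnP b.1 a.1.
  have -> : vee g [:: a, b & w] = (a.2 == g) && vee g (b :: w) by rewrite /= ba.
  have -> : incK g [:: a, b & w] = 0.
    by rewrite /incK /= leqNgt ba andbF.
  rewrite mulr0 add0r.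
  transitivity ((a.2 == g)%:R * veeK g (b :: w)); last first.
    by rewrite IHw; case: (_ == _); rewrite /= ?mul1r ?mul0r ?mulr0.
  rewrite /veeK /conv (big_cuts_cons (fun x y => decK g x * incK g y)).
  rewrite mulrDr big_distrr /=; congr (_ + _).
    by rewrite /decK /= !andbT mul1r.
  apply: eq_bigr => p _; rewrite mulrA; congr (_ * _).
  rewrite /decK /= ba /=; case: (a.2 == g); rewrite /= ?mul1r ?mul0r //.
  case: (b.2 == g) => /=; last by rewrite andbF.
  case: (boolP (all (fun c => c.1 < b.1)%N p.1)) => [H|]; last by rewrite andbF.
  by rewrite (sub_all _ H) // => c /ltn_trans; apply.
have -> : vee g [:: a, b & w] = (a.2 == g) && inc g (b :: w).
  by rewrite /= ltnNge ab.
have -> : incK g [:: a, b & w] = ((a.2 == g) && inc g (b :: w))%:R.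
  congr (_%:R); rewrite /= ab /=; case: (a.2 == g) => //=.
  case: (b.2 == g) => /=; rewrite ?andbF // andbA; congr (_ && _).
  case: (boolP (all (fun c => b.1 <= c.1)%N w)) => [H|]; last by rewrite andbF.
  by rewrite andbT; apply: sub_all H => c; apply: leq_trans.
rewrite big1 ?addr0 => [|p _]; last first.
  by rewrite /decK /= ltnNge ab andbF mul0r.
rewrite /decK /incK /= !andbT.
by case: (a.2 == g); rewrite /=; ring.
Qed.

End Patterns.

(** * Coloured permutations and their words *)

Section RankPerm.
Variable n : nat.

(** The rank of i is the number of indices with a smaller value. *)
Lemma rank_perm_subproof (f : 'I_n -> nat) : injective f ->
  exists s : 'S_n, forall i j, (s i < s j)%N = (f i < f j)%N.
Proof.
move=> f_inj; pose A i := [set j | f j < f i]%N.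
have ltA i : (#|A i| < n)%N.
  rewrite -[X in (_ < X)%N]card_ord -cardsT proper_card // properT.
  by apply/eqP/setP => /(_ i); rewrite !inE ltnn.
have homoA i j : (f i < f j)%N -> (#|A i| < #|A j|)%N.
  move=> fij; apply/proper_card/properP; split.
    by apply/subsetP => k; rewrite !inE => /ltn_trans; apply.
  by exists i; rewrite !inE ?ltnn.
have monoA i j : (#|A i| < #|A j|)%N = (f i < f j)%N.
  apply/idP/idP; last exact: homoA.
  have [//|lt|/f_inj ->] := ltngtP (f i) (f j); last by rewrite ltnn.
  by rewrite ltnNge ltnW // homoA.
have r_inj : injective (fun i => Ordinal (ltA i)).
  move=> i j /(congr1 val)/= Eij; apply: f_inj.
  have := monoA j i; have := monoA i j; rewrite Eij ltnn.
  by case: (ltngtP (f i) (f j)).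
by exists (perm r_inj) => i j; rewrite !permE /= monoA.
Qed.

Lemma card_ord_lt (k : 'I_n) : #|[set j : 'I_n | (j < k)%N]| = k.
Proof.
by rewrite -sum1dep_card (big_ord_narrow (ltnW (ltn_ord k))) sum1_card card_ord.
Qed.

Lemma perm_order_card (s : 'S_n) i : #|[set j | s j < s i]%N| = s i.
Proof.
rewrite -[RHS]card_ord_lt -(card_imset _ (@perm_inj _ s)); congr #|pred_of_set _|.
apply/setP => k; rewrite inE; apply/imsetP/idP => [[j]|lt].
  by rewrite inE => ? ->.
by exists (s^-1 k)%g; rewrite ?inE permKV.
Qed.

(** A permutation is determined by the relative order of its values, since each
    value counts the smaller ones. *)
Lemma perm_order_inj (s t : 'S_n) :
  (forall i j, (s i < s j)%N = (t i < t j)%N) -> s = t.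
Proof.
move=> st; apply/permP => i; apply: val_inj => /=.
rewrite -[LHS]perm_order_card -[RHS]perm_order_card.
by congr #|pred_of_set _|; apply/setP => j; rewrite !inE st.
Qed.

Definition rank_perm (f : 'I_n -> nat) : 'S_n :=
  odflt 1%g [pick s : 'S_n | [forall i, forall j, (s i < s j)%N == (f i < f j)%N]].

Lemma rank_permP f : injective f ->
  forall i j, (rank_perm f i < rank_perm f j)%N = (f i < f j)%N.
Proof.
move=> f_inj i j; rewrite /rank_perm; case: pickP => /= [s|].
  by move/forallP/(_ i)/forallP/(_ j)/eqP.
have [s sP] := rank_perm_subproof f_inj => /(_ s)/negP[].
by apply/forallP => k; apply/forallP => l; rewrite sP.
Qed.

End RankPerm.

Section Words.
Variable gT : finGroupType.
Local Notation word := (seq (nat * gT)).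
Local Notation cw := (@coloured_word gT _).

Lemma size_cw n (a : wreath gT n) : size (cw a) = n.
Proof. by rewrite size_map size_enum_ord. Qed.

Lemma cw_unzip1 n (a : wreath gT n) : unzip1 (cw a) =
  [seq (a.1 k).+1 | k <- enum 'I_n].
Proof. by rewrite /unzip1 -map_comp. Qed.

Lemma cw_inj n : injective (@coloured_word gT n).
Proof.
move=> [s g] [t h] /eq_in_map E; congr pair.
  by apply/permP => i; apply: val_inj; case: (E i (mem_enum _ _)).
by apply/ffunP => i; case: (E i (mem_enum _ _)).
Qed.

Lemma perm_iotaS n (s : 'S_n) :
  perm_eq [seq (s k).+1 | k <- enum 'I_n] (iota 1 n).
Proof.
have pe : perm_eq [seq s k | k <- enum 'I_n] (enum 'I_n).
  apply: uniq_perm; first by rewrite (map_inj_uniq (@perm_inj _ s)) enum_uniq.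
    exact: enum_uniq.
  move=> k; rewrite mem_enum; apply/mapP; exists (s^-1 k)%g; rewrite ?permKV //.
  by rewrite mem_enum.
rewrite -[1%N]addn0 iotaDl -val_enum_ord -map_comp.
by rewrite (map_comp (fun k : 'I_n => k.+1)) perm_map.
Qed.

Lemma perm_cw n (a : wreath gT n) : perm_eq (unzip1 (cw a)) (iota 1 n).
Proof. by rewrite cw_unzip1 perm_iotaS. Qed.

Lemma cw_surj n (w : word) : perm_eq (unzip1 w) (iota 1 n) ->
  exists a : wreath gT n, cw a = w.
Proof.
move=> pw; have sz : size w =
  n by rewrite -(size_iota 1 n) -(perm_size pw) size_map.
pose x0 : nat * gT := (0%N, 1%g).
have in_iota (k : 'I_n) : nth x0 w k \in w by rewrite mem_nth // sz.
have lt1 (k : 'I_n) : (0 < (nth x0 w k).1 <= n)%N.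
  by have := map_f fst (in_iota k); rewrite (perm_mem pw) mem_iota.
have pos (k : 'I_n) : (0 < (nth x0 w k).1)%N by case/andP: (lt1 k).
have lt2 (k : 'I_n) : ((nth x0 w k).1.-1 < n)%N by have := lt1 k; lia.
have inj2 : injective (fun k => Ordinal (lt2 k)).
  move=> i j /(congr1 val)/(congr1 S); rewrite /= !prednK ?pos //.
  rewrite -!(nth_map x0 0%N fst) ?sz // => /eqP; rewrite nth_uniq ?size_map ?sz //.
    by move/eqP/val_inj.
  by rewrite (perm_uniq pw) iota_uniq.
exists (perm inj2, [ffun k : 'I_n => (nth x0 w k).2]).
apply: (@eq_from_nth _ x0); rewrite size_cw ?sz // => i lt_i.
rewrite (nth_map (Ordinal lt_i)) ?size_enum_ord //.
set k := nth _ _ _; have -> : i = k by rewrite nth_enum_ord.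
rewrite permE ffunE /= prednK ?pos //.
by rewrite -surjective_pairing.
Qed.

Lemma enum_ordD n m :
  enum 'I_(n + m) = [seq lshift m i | i <- enum 'I_n]
                    ++ [seq rshift n i | i <- enum 'I_m].
Proof.
apply: (inj_map val_inj);
  rewrite val_enum_ord map_cat -map_comp -[X in _ ++ X]map_comp iotaD add0n.
congr (_ ++ _); first by rewrite -val_enum_ord; apply: eq_map.
rewrite -[X in iota X]addn0 iotaDl -val_enum_ord -map_comp.
by apply: eq_map.
Qed.

Lemma cwD n m (c : wreath gT (n + m)) :
  cw c = [seq ((c.1 (lshift m i)).+1, c.2 (lshift m i)) | i <- enum 'I_n]
         ++ [seq ((c.1 (rshift n i)).+1, c.2 (rshift n i)) | i <- enum 'I_m].
Proof. by rewrite /coloured_word enum_ordD map_cat -map_comp -[X in _ ++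
  X]map_comp. Qed.

Lemma times1E n m (a : wreath gT n) (b : wreath gT m) :
  (forall i, (times a b).1 (lshift m i) = lshift m (a.1 i)) *
  (forall i, (times a b).1 (rshift n i) = rshift n (b.1 i)) *
  (forall i, (times a b).2 (lshift m i) = a.2 i) *
  (forall i, (times a b).2 (rshift n i) = b.2 i).
Proof.
split; first split; first split; move=> i; rewrite ?permE ?ffunE /perm_times_fun.
- by rewrite (unsplitK (inl i)).
- by rewrite (unsplitK (inr i)).
- by rewrite (unsplitK (inl i)).
- by rewrite (unsplitK (inr i)).
Qed.

Lemma mulX1 n (u : 'S_n) (a : wreath gT n) :
  (of_perm gT u * a)%g = ((a.1 * u)%g, a.2).
Proof. by congr pair; apply/ffunP => i; rewrite !ffunE /= mul1g. Qed.

Lemma timesV n m (a : wreath gT n) (b : wreath gT m) :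
  (times a b)^-1%g = times a^-1%g b^-1%g.
Proof.
have V2 p (c : wreath gT p) i : (c^-1%g).2 i = (c.2 ((c.1^-1)%g i))^-1%g.
  by rewrite ffunE.
apply: (mulIg (times a b)); rewrite mulVg; congr pair.
  apply/permP => k; rewrite perm1 permM; case: (split_ordP k) => i ->.
    by rewrite !times1E /= permK.
  by rewrite !times1E /= permK.
apply/ffunP => k; rewrite !ffunE; case: (split_ordP k) => i ->.
  by rewrite times1E (unsplitK (inl _)) V2 permK mulVg.
by rewrite times1E (unsplitK (inr _)) V2 permK mulVg.
Qed.

Lemma XP n m (u : 'S_(n + m)) : reflect
  ((forall i j : 'I_n, (u (lshift m i) < u (lshift m j))%N = (i < j)%N) /\
   (forall i j : 'I_m, (u (rshift n i) < u (rshift n j))%N = (i < j)%N))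
  (u \in X n m).
Proof.
rewrite inE; apply: (iffP andP) => -[H1 H2]; split; last 2 first.
- by do 2!apply/forallP=> ?; rewrite H1 implybb.
- by do 2!apply/forallP=> ?; rewrite H2 implybb.
- have mon : {homo (fun i => u (lshift m i)) : i j / (i < j)%N}.
    by move=> i j; move/forallP/(_ i)/forallP/(_ j)/implyP: H1.
  move=> i j; have [/mon//|/mon/ltnW lt|/val_inj ->] := ltngtP i j;
    last by rewrite ltnn.
  by rewrite ltnNge lt.
- have mon : {homo (fun i => u (rshift n i)) : i j / (i < j)%N}.
    by move=> i j; move/forallP/(_ i)/forallP/(_ j)/implyP: H2.
  move=> i j; have [/mon//|/mon/ltnW lt|/val_inj ->] := ltngtP i j;
    last by rewrite ltnn.
  by rewrite ltnNge lt.
Qed.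

Section Decomposition.
Variables n m : nat.

(** The terms of the products of basis elements. *)
Definition glue (t : wreath gT n * wreath gT m * 'S_(n + m)) : wreath gT (n + m) :=
  (of_perm gT t.2 * times t.1.1 t.1.2)%g.

(** The inverse of glue on X: standardize the first n letters and the last m
    letters, and recover u from these two permutations. *)
Definition unglue (c : wreath gT (n + m)) :
  wreath gT n * wreath gT m * 'S_(n + m) :=
  let a := (rank_perm (fun i => c.1 (lshift m i)), [ffun i => c.2 (lshift m i)]) in
  let b := (rank_perm (fun i => c.1 (rshift n i)), [ffun i => c.2 (rshift n i)]) in
  (a, b, ((perm_times a.1 b.1)^-1 * c.1)%g).

Lemma unglueK c : glue (unglue c) = c.
Proof.
rewrite /glue mulX1 /= mulKVg; case: c => s g /=; congr pair.
apply/ffunP => k; rewrite ffunE; case: (split_ordP k) => i ->.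
  by rewrite ffunE.
by rewrite ffunE.
Qed.

Lemma lcol_inj (s : 'S_(n + m)) : injective (fun i => s (lshift m i) : nat).
Proof. by move=> i j /val_inj/perm_inj/lshift_inj. Qed.

Lemma rcol_inj (s : 'S_(n + m)) : injective (fun i => s (rshift n i) : nat).
Proof. by move=> i j /val_inj/perm_inj/rshift_inj. Qed.

(** The quotient u sends the ranks of the first letters to their values, hence
    is increasing there; likewise for the last letters. *)
Lemma unglueX c : (unglue c).2 \in X n m.
Proof.
have [abl abr] := ((times1E (unglue c).1.1 (unglue c).1.2).1.1.1,
                   (times1E (unglue c).1.1 (unglue c).1.2).1.1.2).
apply/XP; split=> i j; rewrite !permM.
  have E k : ((perm_times (unglue c).1.1.1 (unglue c).1.2.1)^-1)%g (lshift m k) =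
     lshift m (((unglue c).1.1.1)^-1%g k).
    by apply: (canLR (permK _)); rewrite abl permKV.
  by rewrite !E -(rank_permP (lcol_inj (s := c.1))) !permKV.
have E k : ((perm_times (unglue c).1.1.1 (unglue c).1.2.1)^-1)%g (rshift n k) =
   rshift n (((unglue c).1.2.1)^-1%g k).
  by apply: (canLR (permK _)); rewrite abr permKV.
by rewrite !E -(rank_permP (rcol_inj (s := c.1))) !permKV.
Qed.

Lemma glueK t : t.2 \in X n m -> unglue (glue t) = t.
Proof.
case: t => [[a b] u] /XP /= [Xl Xr]; rewrite /glue /= mulX1.
have Ea : rank_perm (fun i => ((times a b).1 * u)%g (lshift m i)) = a.1.
  apply: perm_order_inj => i j.
  by rewrite (rank_permP (lcol_inj (s := _))) !permM !times1E Xl.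
have Eb : rank_perm (fun i => ((times a b).1 * u)%g (rshift n i)) = b.1.
  apply: perm_order_inj => i j.
  by rewrite (rank_permP (rcol_inj (s := _))) !permM !times1E Xr.
rewrite /unglue /= Ea Eb; congr (_, _, _); last by rewrite mulKg.
  case: a {Ea Eb} => s g; congr pair; apply/ffunP => i.
  by rewrite ffunE times1E.
case: b {Ea Eb} => s g; congr pair; apply/ffunP => i.
by rewrite ffunE times1E.
Qed.

End Decomposition.
End Words.

(** * Linear extensions and the product of K[G] *)

Section LinExt.
Variables (K : fieldType) (T : choiceType) (V : lmodType K).
Implicit Types (f : T -> V) (x y : {malg K[T]}).

(** Linearity is checked over a common index set that contains all the supports
    involved. *)
Lemma lin_extEw (E : {fset T}) f x : (msupp x `<=` E)%fset ->
  lin_ext f x = \sum_(a <- E) x@_a *: f a.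
Proof.
move=> le; apply: big_fset_incl => // a _ /mcoeff_outdom->.
by rewrite scale0r.
Qed.

Lemma lin_ext_linear f : linear (lin_ext f).
Proof.
move=> c x y; pose E := (msupp x `|` msupp y `|` msupp (c *: x + y))%fset.
have [Ex Ey] : (msupp x `<=` E)%fset /\ (msupp y `<=` E)%fset.
  by rewrite /E -fsetUA fsubsetUl fsetUCA fsubsetUl.
rewrite (lin_extEw f (fsubsetUr _ _ : (_ `<=` E)%fset)).
rewrite (lin_extEw f Ex) (lin_extEw f Ey).
rewrite scaler_sumr -big_split; apply: eq_bigr => a _ /=.
by rewrite mcoeffD mcoeffZ scalerDl scalerA.
Qed.

HB.instance Definition _ f :=
  GRing.isLinear.Build K {malg K[T]} V *:%R (lin_ext f) (lin_ext_linear f).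

Lemma lin_extU f a : lin_ext f << a >> = f a.
Proof.
rewrite (@lin_extEw [fset a]%fset) ?msuppU_le //.
by rewrite big_seq_fset1 mcoeffUU scale1r.
Qed.

End LinExt.

Section Algebra.
Variables (K : fieldType) (gT : finGroupType).
Local Notation word := (seq (nat * gT)).
Local Notation KG := (KG K gT).
Local Notation KG2 := (KG2 K gT).
Local Notation cw := (@coloured_word gT _).
Implicit Types (x y z : KG).

Lemma tensor_linl y : linear (fun x => tensor x y).
Proof. exact: lin_ext_linear. Qed.

Lemma tensor_linr x : linear (fun y => tensor x y).
Proof.
move=> c y z; rewrite /tensor /lin_ext scaler_sumr -big_split /=.
apply: eq_bigr => a _; rewrite -/(lin_ext _ _) linearP scalerDr !scalerA.
by rewrite mulrC.
Qed.
HB.instance Definition _ x :=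
  GRing.isLinear.Build K KG KG2 *:%R (tensor x) (tensor_linr x).

Lemma tensor_suml (I : Type) (r : seq I) (P : pred I) (F : I -> KG) y :
  tensor (\sum_(i <- r | P i) F i) y = \sum_(i <- r | P i) tensor (F i) y.
Proof.
pose L := GRing.isLinear.Build K KG KG2 *:%R _ (tensor_linl y).
pose f : {linear KG -> KG2} := HB.pack (fun x => tensor x y) L.
exact: (linear_sum f).
Qed.

Lemma tensorZl c x y : tensor (c *: x) y = c *: tensor x y.
Proof.
pose L := GRing.isLinear.Build K KG KG2 *:%R _ (tensor_linl y).
pose f : {linear KG -> KG2} := HB.pack (fun x => tensor x y) L.
exact: (linearZ_LR f).
Qed.

Lemma tensorUU (a b : Gpt gT) : tensor (<< a >> : KG) << b >> = << (a, b) >>.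
Proof. by rewrite /tensor !lin_extU. Qed.

HB.instance Definition _ x :=
  GRing.isLinear.Build K KG KG *:%R (KGmul x)
    (fun c y z => etrans (f_equal (@mul_tensor K gT) (linearP (tensor x) c y z))
       (linearP (@mul_tensor K gT : {linear _ -> _}) c _ _)).

Lemma KGmul_suml (I : Type) (r : seq I) (P : pred I) (F : I -> KG) y :
  KGmul (\sum_(i <- r | P i) F i) y = \sum_(i <- r | P i) KGmul (F i) y.
Proof. by rewrite /KGmul tensor_suml /mul_tensor linear_sum. Qed.

Lemma KGmulZl c x y : KGmul (c *: x) y = c *: KGmul x y.
Proof. by rewrite /KGmul tensorZl /mul_tensor linearZ. Qed.

Lemma KGmulUU (a b : Gpt gT) : KGmul (<< a >> : KG) << b >> = bas_mul K a b.
Proof. by rewrite /KGmul tensorUU /mul_tensor lin_extU. Qed.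

Lemma tensor_mapUU (f g : KG -> KG) a b :
  tensor_map f g << (a, b) >> = tensor (f << a >>) (g << b >>).
Proof. by rewrite /tensor_map lin_extU. Qed.

HB.instance Definition _ f g :=
  GRing.Linear.copy (@tensor_map K gT f g) (lin_ext _).
HB.instance Definition _ := GRing.Linear.copy (@mul_tensor K gT) (lin_ext _).
HB.instance Definition _ := GRing.Linear.copy (@coprod K gT) (lin_ext _).
HB.instance Definition _ :=
  GRing.Linear.copy (@counit K gT : KG -> K^o) (lin_ext _).

Lemma KG_span x : x = \sum_(a <- msupp x) x@_a *: << a >>.
Proof.
rewrite {1}[x]monalgE; apply: eq_bigr => a _; apply/malgP => b.
by rewrite mcoeffZ !mcoeffU mulr_natr.
Qed.

Lemma tensor_mapE (f g : {linear KG -> KG}) x y :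
  tensor_map f g (tensor x y) = tensor (f x) (g y).
Proof.
have span (h : {linear KG -> KG}) z : h z = \sum_(a <- msupp z) z@_a *: h << a >>.
  by rewrite {1}[z]KG_span linear_sum; apply: eq_bigr => a _; rewrite linearZ.
rewrite (span f) (span g) [x in LHS]KG_span [y in LHS]KG_span !tensor_suml.
rewrite [LHS]linear_sum; apply: eq_bigr => a _; rewrite !tensorZl linearZ.
congr (_ *: _); rewrite [tensor _ _]linear_sum [LHS]linear_sum [RHS]linear_sum;
  apply: eq_bigr => b _.
by rewrite !linearZ; congr (_ *: _); rewrite /= tensorUU tensor_mapUU.
Qed.

(** Elements of degree N are handled through their coefficient functions on
    words, so that statements on permutations become statements on lists. *)
Definition word_sum N (F : word -> K) : KG :=
  \sum_(a : wreath gT N) F (cw a) *: bas K a.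

Lemma eq_word_sum N (F F' : word -> K) :
  (forall a : wreath gT N, F (cw a) = F' (cw a)) -> word_sum N F = word_sum N F'.
Proof. by move=> FF'; apply: eq_bigr => a _; rewrite FF'. Qed.

Lemma relabel_word (U : Type) (F : word -> U) n (a : wreath gT n) (h : 'I_n ->
  nat) :
  order_inv F -> {mono h : i j / (i < j)%N} ->
  F [seq ((h (a.1 k)).+1, a.2 k) | k <- enum 'I_n] = F (cw a).
Proof.
move=> FI hM; pose f k := if insub k.-1 is Some i then (h i).+1 else 0%N.
have fE (i : 'I_n) : f i.+1 = (h i).+1 by rewrite /f /= valK.
have fM : {in unzip1 (cw a) &, {mono f : k l / (k < l)%N}}.
  by move=> _ _ /[!cw_unzip1] /mapP[k _ ->] /mapP[l _ ->]; rewrite !fE !ltnS hM.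
rewrite -(FI _ _ fM); congr F; rewrite /relabel -[RHS]map_comp; apply: eq_map => k.
by rewrite /= fE.
Qed.

Lemma glue_take (U : Type) (F : word -> U) n m
    (t : wreath gT n * wreath gT m * 'S_(n + m)) :
  order_inv F -> t.2 \in X n m -> F (take n (cw (glue t))) = F (cw t.1.1).
Proof.
case: t => [[a b] u] FI /XP[ul ur] /=.
rewrite cwD take_size_cat; last by rewrite size_map size_enum_ord.
rewrite -(relabel_word a FI ul).
congr F; apply: eq_map => k.
by rewrite /glue mulX1 /= permM !times1E.
Qed.

Lemma glue_drop (U : Type) (F : word -> U) n m
    (t : wreath gT n * wreath gT m * 'S_(n + m)) :
  order_inv F -> t.2 \in X n m -> F (drop n (cw (glue t))) = F (cw t.1.2).
Proof.
case: t => [[a b] u] FI /XP[ul ur] /=.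
rewrite cwD drop_size_cat; last by rewrite size_map size_enum_ord.
rewrite -(relabel_word b FI ur).
congr F; apply: eq_map => k.
by rewrite /glue mulX1 /= permM !times1E.
Qed.

(** Every coloured permutation of size n + m occurs exactly once as u (a x b)
    with u in X, and then a and b are the standardizations of its first n and
    of its last m letters.  So the product of two order invariant coefficient
    functions is evaluated on the two factors of a word. *)
Lemma KGmul_word_sum n m (F F' : word -> K) : order_inv F -> order_inv F' ->
  KGmul (word_sum n F) (word_sum m F')
  = word_sum (n + m) (fun w => F (take n w) * F' (drop n w)).
Proof.
move=> FI FI'; rewrite /word_sum KGmul_suml.
under eq_bigr => a _ do rewrite linear_sum.
rewrite pair_big /=.
under eq_bigr => p _ do
  rewrite KGmulZl linearZ /= /bas KGmulUU /bas_mul scalerA scaler_sumr.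
rewrite (pair_big_dep xpredT (fun p u => u \in X n m) (fun p u =>
  (F (cw p.1) * F' (cw p.2)) *: bas K (of_perm gT u * times p.1 p.2)%g)) /=.
rewrite (reindex_onto (@unglue gT n m) (@glue gT n m)) => [|t tX];
  last exact: glueK.
apply: eq_big => [c|c _]; first by rewrite unglueX unglueK eqxx.
rewrite -(glue_take FI (unglueX c)) -(glue_drop FI' (unglueX c)) unglueK.
by congr (_ *: bas K _); apply: (unglueK c).
Qed.

(** The condition that defines the coproduct selects the standardizations of
    the subwords of the low letters and of the high letters.  Given u, the
    positions of the low letters are the values of u on the first n indices, in
    increasing order, because u is in X.  Conversely, the inverse of a factors
    through X by unglue, and the factors are those that the subwords give. *)
Lemma restr_words n m (a : wreath gT (n + m)) (b : wreath gT n) (c : wreath gT m) :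
  [exists u in X n m, a^-1%g == (of_perm gT u * (times b c)^-1)%g] =
  ([seq x <- cw a | x.1 <= n]%N == cw b) &&
  ([seq x <- cw a | ~~ (x.1 <= n)]%N == relabel (addn n) (cw c)).
Proof.
have dir (b' : wreath gT n) (c' : wreath gT m) :
    [exists u in X n m, a^-1%g == (of_perm gT u * (times b' c')^-1)%g] ->
    [seq x <- cw a | x.1 <= n]%N = cw b' /\
    [seq x <- cw a | ~~ (x.1 <= n)]%N = relabel (addn n) (cw c').
  case/exists_inP => u /XP[ul ur] /eqP E.
  have {}E : a = (times b' c' * (of_perm gT u)^-1)%g.
    by rewrite -[a]invgK E invMg !invgK.
  have aE k : (a.1 (u k) = (times b' c').1 k) * (a.2 (u k) = (times b' c').2 k).
    rewrite E; split; first by rewrite /= permM permK.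
    have o2 i : (of_perm gT u).2 i = 1%g by rewrite ffunE.
    by rewrite [LHS]ffunE [X in (_ * X)%g]ffunE o2 invg1 mulg1 /= permK.
  have sorted_enum p : sorted (fun i j : 'I_p => i < j)%N (enum 'I_p).
    by have := iota_ltn_sorted 0 p; rewrite -val_enum_ord sorted_map.
  pose P (k : 'I_(n + m)) := (a.1 k < n)%N.
  have PE k : P (u k) = (k < n)%N.
    rewrite /P aE; case: (split_ordP k) => i -> /=; rewrite times1E /=.
      by rewrite !ltn_ord.
    by rewrite !ltnNge !leq_addr.
  have El : [seq k <- enum 'I_(n + m) | P k] =
    [seq u (lshift m i) | i <- enum 'I_n].
    apply: (@irr_sorted_eq _ (fun i j : 'I_(n + m) => i < j)%N).
    - by move=> ? ? ?; apply: ltn_trans.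
    - by move=> ?; apply: ltnn.
    - by apply: sorted_filter (sorted_enum _) => ? ? ?; apply: ltn_trans.
    - rewrite sorted_map; apply: sub_sorted (sorted_enum n) => i j.
      by rewrite /= ul.
    move=> k; rewrite mem_filter mem_enum andbT; apply/idP/mapP => [Pk|[i _ ->]].
      have := Pk; rewrite -(permKV u k) PE => lt.
      exists (Ordinal lt); rewrite ?mem_enum //.
      by congr (u _); apply: val_inj.
    by rewrite PE /=.
  have Er : [seq k <- enum 'I_(n + m) | ~~ P k] =
    [seq u (rshift n i) | i <- enum 'I_m].
    apply: (@irr_sorted_eq _ (fun i j : 'I_(n + m) => i < j)%N).
    - by move=> ? ? ?; apply: ltn_trans.
    - by move=> ?; apply: ltnn.
    - by apply: sorted_filter (sorted_enum _) => ? ? ?; apply: ltn_trans.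
    - rewrite sorted_map; apply: sub_sorted (sorted_enum m) => i j.
      by rewrite /= ur.
    move=> k; rewrite mem_filter mem_enum andbT; apply/idP/mapP => [Pk|[i _ ->]].
      have := Pk; rewrite -(permKV u k) PE.
      case: (split_ordP _) => i -> /=; rewrite ?ltn_ord // => _.
      by exists i; rewrite ?mem_enum.
    by rewrite PE /= ltnNge leq_addr.
  split; rewrite /coloured_word filter_map.
    rewrite (eq_filter (a2 := P)) // El -map_comp; apply: eq_map => i.
    by rewrite /= !aE !times1E.
  rewrite (eq_filter (a2 := predC P)) // Er -map_comp /relabel -map_comp.
  apply: eq_map => i.
  by rewrite /= !aE !times1E /= addnS.
apply/idP/andP => [/dir[-> ->] //|[/eqP Eb /eqP Ec]].
pose t := unglue a^-1%g.
have ex : [exists u in X n m, a^-1%g == (of_perm gT u * (times t.1.1^-1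
  t.1.2^-1)^-1)%g].
  apply/exists_inP; exists t.2; first exact: unglueX.
  by rewrite timesV !invgK -[X in X == _]unglueK.
have [Eb' Ec'] := dir _ _ ex.
have -> : b = t.1.1^-1%g by apply: cw_inj; rewrite -Eb -Eb'.
suff -> : c = t.1.2^-1%g by [].
apply: cw_inj; apply: (@inj_map _ _ (fun x : nat * gT => ((n + x.1)%N, x.2))).
  by move=> [x1 x2] [y1 y2] [/addnI -> ->].
exact: etrans (esym Ec) Ec'.
Qed.

End Algebra.

(** * The coproduct of K[G] in terms of words *)

Section Coproduct.
Variables (K : fieldType) (gT : finGroupType).
Local Notation word := (seq (nat * gT)).
Local Notation KG := (KG K gT).
Local Notation KG2 := (KG2 K gT).
Local Notation cw := (@coloured_word gT _).

Lemma cw_bounds n (a : wreath gT n) : all (fun l => 0 < l.1 <= n)%N (cw a).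
Proof.
apply/allP => l /(map_f fst); rewrite -/(unzip1 _) (perm_mem (perm_cw a)).
by rewrite mem_iota.
Qed.

Lemma below_cw n m (b : wreath gT n) (c : wreath gT m) :
  below (cw b) (relabel (addn n) (cw c)).
Proof.
apply/allrelP => k l /(allP (cw_bounds b)) + /mapP[l' /(allP (cw_bounds c)) + ->].
by move=> /andP[_ le] /andP[lt _] /=; lia.
Qed.

(** The coloured permutations whose low and high subwords are given are the
    shuffles of these subwords.  The equation on N lets N - i be treated as a
    variable. *)
Lemma sum_restr N n m (b : wreath gT n) (c : wreath gT m) (F : word -> K) :
  N = (n + m)%N ->
  \sum_(a : wreath gT N |
      [exists u in X n m, pt a^-1%g == pt (of_perm gT u * (times b c)^-1)%g])
    F (cw a)
  = \sum_(w <- shuffles (cw b) (relabel (addn n) (cw c))) F w.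
Proof.
move=> ->; pose P (l : nat * gT) := (l.1 <= n)%N.
have Pb : all P (cw b) by apply: sub_all (cw_bounds b) => l /andP[].
have Pc : all (predC P) (relabel (addn n) (cw c)).
  by rewrite all_map; apply: sub_all (cw_bounds c) => l /andP[lt _];
    rewrite /P /=; lia.
rewrite (eq_bigl (fun a => ([seq x <- cw a | P x] == cw b) &&
    ([seq x <- cw a | ~~ P x] == relabel (addn n) (cw c)))); last first.
  move=> a; rewrite -restr_words; apply: eq_existsb => u.
  by rewrite eq_Tagged.
rewrite -big_enum_cond -big_filter.
rewrite -(big_map (fun a => cw a) xpredT F); apply: perm_big.
apply: uniq_perm.
- by rewrite (map_inj_uniq (@cw_inj _ _)) filter_uniq // enum_uniq.
- exact: (@uniq_shuffles _ P).
move=> w; rewrite (@mem_shuffles _ P) //; apply/mapP/idP => [[a + ->]|Ew].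
  by rewrite mem_filter mem_enum andbC.
have [a Ea] : exists a : wreath gT (n + m), cw a = w.
  apply: cw_surj; have pw : perm_eq w (cw b ++ relabel (addn n) (cw c)).
    by case/andP: Ew => /eqP<- /eqP<-; rewrite perm_sym perm_filterC.
  rewrite (perm_trans (perm_map _ pw)) // map_cat iotaD.
  apply: perm_cat; first exact: perm_cw.
  rewrite /relabel -map_comp addnC iotaDl.
  rewrite (eq_map (g := addn n \o fst)) // map_comp.
  by apply: perm_map; apply: perm_cw.
exists a => //; rewrite mem_filter mem_enum andbC unfold_in Ea.
exact: Ew.
Qed.

(** On coefficient functions the coproduct is dual to the shifted shuffle. *)
Lemma coprod_word_sum N (F : word -> K) :
  coprod (word_sum N F) = \sum_(i < N.+1) \sum_(b : wreath gT i)
     \sum_(c : wreath gT (N - i))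
       (\sum_(w <- shuffles (cw b) (relabel (addn i) (cw c))) F w)
         *: << (pt b, pt c) >>.
Proof.
rewrite /word_sum linear_sum /=.
transitivity (\sum_(a : wreath gT N) \sum_(i < N.+1)
    \sum_(bc : wreath gT i * wreath gT (N - i) |
       [exists u in X i (N - i),
          pt a^-1%g == pt (of_perm gT u * (times bc.1 bc.2)^-1)%g])
      F (cw a) *: (<< (pt bc.1, pt bc.2) >> : KG2)).
  apply: eq_bigr => a _.
  rewrite linearZ /= /coprod /bas lin_extU /bas_coprod scaler_sumr.
  by apply: eq_bigr => i _; rewrite scaler_sumr.
rewrite exchange_big; apply: eq_bigr => i _ /=; rewrite pair_big /=.
rewrite (exchange_big_dep xpredT) //=; apply: eq_bigr => -[b c] _ /=.
rewrite -scaler_suml; congr (_ *: _); apply: sum_restr.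
by rewrite subnKC // -ltnS.
Qed.

Section Blocks.
Variable phi : gT -> word -> K.
Hypothesis phiI : forall g, order_inv (phi g).
Hypothesis phiC : forall g, shuffle_char (phi g).

(** The product, over the letters (n, g) of v, of the sums of (phi g w) w over
    the words w of size n; see block_sum_cat. *)
Definition block_sum v : KG := word_sum (weight v) (block_coef phi v).

(** Each block of characters is a divided power sequence, so the coproduct of a
    product of blocks is the sum over all splittings of the block sizes. *)
Lemma coprod_block_sum v :
  coprod (block_sum v) =
    \sum_(p <- splits v) tensor (block_sum p.1) (block_sum p.2).
Proof.
rewrite /block_sum coprod_word_sum.
under eq_bigr => i _ do under eq_bigr => b _ do under eq_bigr => c _ do
  rewrite (block_coef_shuffles phiC _ (below_cw b c)) scaler_suml.
under eq_bigr => i _ do under eq_bigr => b _ do rewrite exchange_big /=.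
under eq_bigr => i _ do rewrite exchange_big /=.
rewrite exchange_big big_seq [RHS]big_seq; apply: eq_bigr => p ps /=.
have Ew := weight_splits ps.
have lt : (weight p.1 < (weight v).+1)%N by rewrite ltnS -Ew leq_addr.
rewrite (bigD1 (Ordinal lt)) //= [X in _ + X]big1 ?addr0; last first.
  move=> i; rewrite -val_eqE /= => neq; rewrite big1 // => b _;
    rewrite big1 // => c _.
  by rewrite block_coef_size ?mul0r ?scale0r // size_cw.
have -> : (weight v - weight p.1)%N = weight p.2 by rewrite -Ew addKn.
rewrite /word_sum tensor_suml; apply: eq_bigr => b _.
rewrite linear_sum; apply: eq_bigr => c _.
rewrite linearZ /= tensorZl /bas tensorUU scalerA mulrC; congr (_ * _ *: _).
by apply: block_coef_inv => // x y _ _; rewrite ltn_add2l.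
Qed.

Lemma block_sum_cat v1 v2 : block_sum (v1 ++ v2) =
  KGmul (block_sum v1) (block_sum v2).
Proof.
rewrite /block_sum KGmul_word_sum; try by apply: block_coef_inv.
rewrite /weight /unzip1 map_cat sumn_cat; apply: eq_word_sum => a.
by rewrite block_coef_cat ?size_cw.
Qed.

Lemma block_sum_nil : block_sum [::] = KGone K gT.
Proof.
rewrite /block_sum /word_sum /KGone (big_pred1 (1%g : wreath gT 0)) => [|a].
  by rewrite /= (size0nil (size_cw _)) eqxx scale1r.
symmetry; apply/eqP/cw_inj.
by rewrite (size0nil (size_cw a)) (size0nil (size_cw _)).
Qed.

Lemma counit_word_sum N (F : word -> K) :
  counit (word_sum N F) = (N == 0%N)%:R * F [::].
Proof.
rewrite /word_sum (linear_sum (@counit K gT : _ -> K^o)).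
under eq_bigr => a _ do
  rewrite (linearZ_LR (@counit K gT : _ -> K^o)) /= /counit /bas lin_extU /=.
case: N => [|N]; last by rewrite mul0r big1 // => a _; rewrite scaler0.
rewrite (big_pred1 (1%g : wreath gT 0)) => [|a].
  by rewrite (size0nil (size_cw _)) mul1r; apply: mulr1.
symmetry; apply/eqP/cw_inj.
by rewrite (size0nil (size_cw a)) (size0nil (size_cw _)).
Qed.

Lemma counit_block_sum v : counit (block_sum v) = (weight v == 0%N)%:R.
Proof.
rewrite /block_sum counit_word_sum; case: eqP => [v0|]; last by rewrite mul0r.
rewrite mul1r; elim: v v0 => [|[n g] v IHv] //; rewrite weight_cons => v0.
have [-> /IHv E] : n = 0%N /\ weight v = 0%N by lia.
by rewrite block_coef_take //= E mulr1 (phiC g).1.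
Qed.
End Blocks.
End Coproduct.

(** * Descent and peak compositions of coloured words *)

Section Runs.
Local Open Scope nat_scope.
Variable gT : finGroupType.
Local Notation word := (seq (nat * gT)).
Local Notation cw := (@coloured_word gT _).
Implicit Types (w : word) (g h : gT) (l : seq (bool * gT)) (t up : bool).

(** The breaks of x :: w after each letter, together with the colour of the
    next letter.  A colour change always breaks.  If t holds, so does every
    descent; otherwise only an interior peak does, that is, a descent preceded
    by an ascent of the same colour, as recorded by up.  Treating both cases at
    once makes D_G and the interior peak composition instances of runs. *)
Fixpoint flags t up (x : nat * gT) w : seq (bool * gT) :=
  if w is y :: w' then
    ((x.2 != y.2) || (up && (y.1 < x.1)), y.2)
      :: flags t (t || ((x.2 == y.2) && (x.1 < y.1))) y w'
  else [::].

(** The block in progress has size n and colour g. *)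
Fixpoint cut_blocks n g l : seq (nat * gT) :=
  if l is (b, h) :: l' then
    if b then (n, g) :: cut_blocks 1 h l' else cut_blocks n.+1 g l'
  else [:: (n, g)].

Definition runs t w : seq (nat * gT) :=
  if w is x :: w' then cut_blocks 1 x.2 (flags t t x w') else [::].

Lemma cut_blocks_cat n g l h l' :
  cut_blocks n g (l ++ (true, h) :: l') = cut_blocks n g l ++ cut_blocks 1 h l'.
Proof. by elim: l n g => [|[[] k] l IHl] n g //=; rewrite IHl. Qed.

Lemma flags_cat t up x w y w' : (last x w).2 != y.2 ->
  flags t up x (w ++ y :: w') = flags t up x w ++ (true, y.2) :: flags t t y w'.
Proof.
elim: w x up => [|z w IHw] x up /= neq; last by rewrite IHw.
by rewrite neq (negbTE neq) orbF.
Qed.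

Definition mono_word (vg : seq nat * gT) : word := [seq (k, vg.2) | k <- vg.1].

Definition rainbow_ok (r : seq (seq nat * gT)) :=
  all (fun vg => vg.1 != [::]) r && sorted (fun p q => p.2 != q.2) r.

Lemma rainbowP w :
  rainbow_ok (rainbow w) /\ flatten (map mono_word (rainbow w)) = w.
Proof.
elim: w => [|[a g] w [ok E]] //=; case: (rainbow w) ok E => [|[v h] r] /=.
  by move=> _ <-.
rewrite /rainbow_ok /= => /andP[/andP[v0 all_r] srt] E.
have [->|neq] := eqVneq g h; rewrite /= ?v0 all_r /= ?neq ?srt -?E; split=> //.
  by case: (r) srt.
Qed.

Lemma runs_cat t vg w : vg.1 != [::] ->
  (if w is y :: _ then vg.2 != y.2 else true) ->
  runs t (mono_word vg ++ w) = runs t (mono_word vg) ++ runs t w.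
Proof.
case: vg => [[|a v] g] // _; case: w => [|y w] /= neq; first by rewrite !cats0.
rewrite flags_cat ?cut_blocks_cat // (_ : (last _ _).2 = g) //.
by elim: (v) a => //=.
Qed.

(** A colour change breaks and resets the state, so that the runs can be
    computed on each rainbow factor separately. *)
Lemma runs_rainbow t w :
  runs t w = flatten [seq runs t (mono_word vg) | vg <- rainbow w].
Proof.
have [ok {1}<-] := rainbowP w; elim: (rainbow w) ok => [|vg r IHr] //=.
case/andP=> /= /andP[v0 all_r] srt.
rewrite runs_cat // ?IHr // /rainbow_ok ?all_r ?(path_sorted srt) //.
case: r srt all_r {IHr} => [|[[|b v] h] r] //=.
by case/andP.
Qed.

(** The common form of the conditions that define Des and Peak. *)
Definition turn t (val : nat -> nat) i :=
  (t || ((1 < i) && (val i.-1 < val i))) && (val i.+1 < val i).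

Lemma comp_cut (P : pred nat) g q p k : k < p ->
  [seq (c, g) | c <- pairmap (fun i j => j - i) k
                       (rcons [seq i <- iota p q | P i] (p + q))] =
  cut_blocks (p - k) g [seq (P i, g) | i <- iota p q].
Proof.
elim: q p k => [|q IHq] p k lt /=; first by rewrite addn0.
rewrite addnS -addSn; case: (P p) => /=.
  by rewrite IHq // subSnn.
by rewrite IHq ?subSn ?(ltnW lt) // ltnW.
Qed.

Lemma flags_mono t up g a v p (val : nat -> nat) :
  (forall j, j <= size v -> val (p + j) = nth 0 (a :: v) j) ->
  flags t up (a, g) [seq (k, g) | k <- v] =
  [seq ((if i == p then up else t || (val i.-1 < val i)) && (val i.+1 < val i), g)
  | i <- iota p (size v)].
Proof.
elim: v a p up => [|b v IHv] a p up valE //=.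
have v0 := valE 0 isT; have v1 := valE 1 isT; rewrite /= addn0 addn1 in v0 v1.
rewrite !eqxx /= v0 v1; congr (_ :: _).
rewrite (IHv _ p.+1) => [|j lt]; last by rewrite addSnnS valE.
apply/eq_in_map => i; rewrite mem_iota => /andP[lt _].
rewrite (gtn_eqF lt); case: eqP => // ->.
by rewrite /= v0 v1.
Qed.

Lemma value_nth n (s : 'S_n) (k : 'I_n) : value s k.+1 = (s k).+1.
Proof.
rewrite /value /= (nth_map k) ?size_enum_ord // ?nth_ord_enum //.
Qed.

Lemma std_order (v : seq nat) (i j : 'I_(size v)) : uniq v ->
  (std v i < std v j) = (nth 0 v i < nth 0 v j).
Proof.
move=> v_uniq; pose f (k : 'I_(size v)) := nth 0 v k.
have f_inj : injective f.
  by move=> k l /eqP; rewrite nth_uniq // => /eqP/val_inj.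
suff H (k l : 'I_(size v)) : k < l -> (std v l < std v k) = (f l < f k).
  (* Only pairs i < j are constrained by the definition of std. *)
  have [lt|lt|/val_inj->] := ltngtP i j; last by rewrite !ltnn.
    have := H _ _ lt; rewrite -/(f i) -/(f j).
    case: (ltngtP (f i) (f j)) => [?|?|/f_inj E]; last by rewrite E ltnn in lt.
      case: ltngtP => // /val_inj/perm_inj E; by rewrite E ltnn in lt.
    by case: ltngtP.
  by rewrite H.
rewrite /std; case: pickP => /= [s /forallP/(_ k)/forallP/(_ l)/implyP H|].
  by move/H/eqP.
move/(_ (rank_perm f))/negP => []; apply/forallP => k'; apply/forallP => l'.
by apply/implyP => _; rewrite (rank_permP f_inj).
Qed.

(** On a monochromatic word the compositions given by descents or peaks of the
    standardization agree with the runs of the word itself, because the two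
    have the same relative order. *)
Lemma turn_runs t v g : uniq v -> v != [::] ->
  [seq (c, g) | c <- comp_of_set (size v)
      [seq i <- iota 1 (size v).-1 | turn t (value (std v)) i]] =
  runs t (mono_word (v, g)).
Proof.
case: v => // a v v_uniq _; rewrite /comp_of_set.
have := @comp_cut (turn t (value (std (a :: v)))) g (size v) 1 0 isT.
rewrite add1n subn0 => -> /=; congr cut_blocks.
rewrite (@flags_mono _ _ _ _ _ 1 (fun i => nth 0 (a :: v) i.-1)) //.
have valE i j : 0 < i <= (size v).+1 -> 0 < j <= (size v).+1 ->
    (value (std (a :: v)) i < value (std (a :: v)) j)
    = (nth 0 (a :: v) i.-1 < nth 0 (a :: v) j.-1).
  case: i j => [|i] [|j] //= lei lej.
  rewrite (value_nth (std (a :: v)) (Ordinal (lei : i < size (a :: v)))).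
  rewrite (value_nth (std (a :: v)) (Ordinal (lej : j < size (a :: v)))).
  by rewrite ltnS std_order.
apply/eq_in_map => i; rewrite mem_iota add1n => /andP[i0 lei]; congr (_, _).
rewrite /turn [X in _ && X]valE ?i0 ?(ltnW lei) //; congr (_ && _).
have [->|neq] := eqVneq i 1; first by rewrite ltnn orbF.
case: i i0 lei neq => [|[|i]] //= _ lei _; have lei' := ltnW lei.
by rewrite valE //= (ltnW lei').
Qed.

Lemma rainbow_uniq w vg : uniq (unzip1 w) -> vg \in rainbow w -> uniq vg.1.
Proof.
have [_ {1}<-] := rainbowP w; elim: (rainbow w) => [|vg' r IHr] //=.
rewrite /unzip1 map_cat cat_uniq inE => /and3P[u1 _ u2] /orP[/eqP->|];
  last exact: IHr.
by move: u1; rewrite -map_comp map_id_in.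
Qed.

Lemma rainbow_nil w vg : vg \in rainbow w -> vg.1 != [::].
Proof. by have [/andP[/allP/(_ vg)]] := rainbowP w. Qed.

Lemma uniq_cw n (a : wreath gT n) : uniq (unzip1 (cw a)).
Proof. by rewrite (perm_uniq (perm_cw a)) iota_uniq. Qed.

Lemma DesGE n (a : wreath gT n) : DesG a = runs true (cw a).
Proof.
rewrite /DesG /rainbow_lift runs_rainbow; congr flatten; apply/eq_in_map => vg in_r.
have v0 := rainbow_nil in_r; have vu := rainbow_uniq (uniq_cw a) in_r.
by rewrite [vg in RHS]surjective_pairing -turn_runs.
Qed.

Lemma PeakGE n (a : wreath gT n) : PeakG a = runs false (cw a).
Proof.
rewrite /PeakG /rainbow_lift runs_rainbow; congr flatten;
  apply/eq_in_map => vg in_r.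
have v0 := rainbow_nil in_r; have vu := rainbow_uniq (uniq_cw a) in_r.
rewrite [vg in RHS]surjective_pairing -turn_runs //; congr map.
rewrite /Peak_word /Peak; congr comp_of_set; apply: eq_filter => i.
by rewrite /turn andbA.
Qed.

End Runs.

(** * Words that start with an increasing block *)

Section RunsInc.
Variable gT : finGroupType.
Local Notation word := (seq (nat * gT)).
Local Notation cw := (@coloured_word gT _).
Implicit Types (w : word) (g h : gT) (c : seq (nat * gT)).

Lemma flags_relabel t up f x w :
  {in unzip1 (x :: w) &, {mono f : k l / (k < l)%N}} ->
  flags t up (f x.1, x.2) (relabel f w) = flags t up x w.
Proof.
elim: w x up => [|y w IHw] x up // fM.
have [fM' fx] := mono_cons fM.
have [E1 E2] := fx y (mem_head _ _).
by rewrite /= E1 E2 IHw.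
Qed.

Lemma runs_inv t : order_inv (@runs gT t).
Proof. by move=> f [|x w] // fM; rewrite /= flags_relabel. Qed.

Lemma cut_blocks_head l g : exists j r, forall n, @cut_blocks gT n g l =
  ((n + j)%N, g) :: r.
Proof.
elim: l g => [|[[] h] l IHl] g /=.
- by exists 0%N, [::] => n; rewrite addn0.
- by exists 0%N, (cut_blocks 1 h l) => n; rewrite addn0.
have [j [r E]] := IHl g; exists j.+1, r => n.
by rewrite E addSnnS.
Qed.

Lemma flags_inc g x w t : inc g (x :: w) ->
  x.2 = g /\ flags true t x w = nseq (size w) (false, g).
Proof.
elim: w x t => [|y w IHw] x t; first by case/andP=> /eqP.
rewrite [inc _ _]/= => /and3P[/eqP xg /andP[xy xw] incw].
have [yg E] := IHw y true incw; split=> //=.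
by rewrite xg yg eqxx /= ltnNge xy andbF E.
Qed.

Lemma flags_catT t x w y w' :
  flags true t x (w ++ y :: w') =
  flags true t x w
    ++ (((last x w).2 != y.2) || ((t || (w != [::])) && (y.1 < (last x w).1)%N),
      y.2)
    :: flags true true y w'.
Proof.
elim: w x t => [|z w IHw] x t /=; first by rewrite orbF.
by rewrite IHw orbT.
Qed.

Lemma cut_blocks_nseq n g k l :
  cut_blocks n g (nseq k (false, g) ++ l) = cut_blocks (n + k) g l.
Proof.
by elim: k n => [|k IHk] n /=; rewrite ?addn0 // IHk addSnnS.
Qed.

(** Nothing breaks inside an increasing monochromatic word, so only the junction
    with the rest matters. *)
Lemma runs_inc_cat g u z r : u != [::] -> inc g u ->
  runs true (u ++ z :: r) =
  if (g != z.2) || (z.1 < (last z u).1)%N then (size u, g) :: runs true (z :: r)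
  else cut_blocks (size u).+1 g (flags true true z r).
Proof.
case: u => // x u _ incu; have [xg E] := flags_inc true incu.
have lg : (last x u).2 = g.
  elim: u x incu {xg E} => [|y u IHu] x; first by case/andP=> /eqP.
  by rewrite [inc _ _]/= => /and3P[_ _ /IHu].
by rewrite /= flags_catT E lg xg cut_blocks_nseq /= add1n; case: (_ || _).
Qed.

Lemma runs_inc g u : u != [::] -> inc g u -> runs true u = [:: (size u, g)].
Proof.
case: u => // x u _ incu; have [xg E] := flags_inc true incu.
by rewrite /= E xg -[nseq _ _]cats0 cut_blocks_nseq.
Qed.

Lemma inc_take g n w : inc g w -> inc g (take n w).
Proof.
elim: w n => [|x w IHw] [|n] //= /and3P[-> + /IHw->]; rewrite andbT /= => /allP le.
by apply/allP => y /mem_take/le.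
Qed.

Lemma runs_head_inc g N c w n :
  runs true w = (N, g) :: c -> (n <= N)%N -> inc g (take n w).
Proof.
case: w => // x w; rewrite [runs _ _]/=.
have H k j t y w' : cut_blocks k y.2 (flags true t y w') = ((k + j)%N, g) :: c ->
  t ->
    inc g (take j.+1 (y :: w')).
  elim: w' k j t y => [|z w' IHw'] k j t y /=.
    by case=> _ -> _; rewrite eqxx.
  case: ifP => [_ [E -> _] _|/negbT].
    have -> : j = 0%N by lia.
    by rewrite take0 /= eqxx.
  rewrite negb_or negbK => /andP[/eqP Eyz]; case: t => //= yz.
  rewrite Eyz; case: j => [|j] E _.
    have [j' [r E']] := cut_blocks_head (flags true true z w') z.2.
    by move: E; rewrite E' => -[]; lia.
  have {}IH : inc g (take j.+1 (z :: w')).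
    by apply: (IHw' k.+1 j true) => //; rewrite addSnnS.
  have /and3P[zg zall zinc] := IH; apply/and3P; split=> //.
  have yz' : (y.1 <= z.1)%N by rewrite leqNgt.
  apply/andP; split=> //; apply: sub_all zall => l; exact: leq_trans.
case: N => [|N] E; first by rewrite leqn0 => /eqP->; rewrite take0.
move=> le; have := H 1%N N true x w; rewrite add1n => /(_ E isT) incN.
by rewrite -(take_takel _ le) inc_take.
Qed.

Lemma weight0 c : is_Gcomp c -> (weight c == 0%N) = (c == [::]).
Proof. by case: c => // -[[|n] g] c. Qed.

(** The coefficientwise form of the multiplication rule for d_(n)^g * d_c: the
    new block is a part of its own or it merges with the first part of c. *)
Lemma inc_runs_split g n c w :
  (0 < n)%N -> is_Gcomp c -> size w = (n + weight c)%N ->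
  (inc g (take n w) && (runs true (drop n w) == c) : nat) =
  ((runs true w == (n, g) :: c) +
   (if c is (m, h) :: c' then (g == h) && (runs true w == ((n + m)%N, g) :: c')
    else false))%N.
Proof.
move=> n0 cG sz; have [incu|ninc] := boolP (inc g (take n w)); last first.
  have N1 : (runs true w == (n, g) :: c) = false.
    by apply: contraNF ninc => /eqP E; apply: (runs_head_inc E).
  rewrite N1; case: c {sz cG N1} => [|[m h] c] //; case: (g == h) => //=.
  case: eqP => // E; case/negP: ninc; apply: (runs_head_inc E).
  by rewrite leq_addr.
have su : size (take n w) = n by rewrite size_takel // sz leq_addr.
have u0 : take n w != [::] by rewrite -size_eq0 su -lt0n.
have sr : size (drop n w) = weight c by rewrite size_drop sz addKn.
rewrite -{2 3}(cat_take_drop n w) /=.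
case: (drop n w) sr => [|z r] sr.
  have /eqP c0 : c == [::] by rewrite -weight0 // -sr.
  by rewrite c0 cats0 (runs_inc u0 incu) su !eqxx.
have Er := runs_inc_cat z r u0 incu; rewrite !{}Er su; case: ifP => [_|].
  rewrite eqseq_cons eqxx /=; case: c cG {sz sr} => [|[m h] c] /= cG;
    first by rewrite addn0.
  rewrite [in X in (_ + X)%N]eqseq_cons xpair_eqE.
  have /negbTE-> : (n != n + m)%N by case/andP: cG; lia.
  by rewrite /= andbF addn0.
move/negbT; rewrite negb_or negbK => /andP[/eqP Eg _].
have [j [r' E]] := cut_blocks_head (flags true true z r) g.
rewrite [runs _ _]/= -Eg !E eqseq_cons xpair_eqE.
have /negbTE-> : (n.+1 + j != n)%N by lia.
rewrite /= add0n; case: c {cG sz sr} => [|[m h] c] //=.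
rewrite !eqseq_cons !xpair_eqE eqxx andbT.
have -> : (n.+1 + j == n + m)%N = (1 + j == m)%N by lia.
by rewrite andbA [(g == h) && _]andbC.
Qed.

(** Put each new block above everything that follows it: within a block the
    word increases, and between two blocks it descends. *)
Lemma runs_exists c : is_Gcomp c ->
  exists2 w, perm_eq (unzip1 w) (iota 1 (weight c)) & runs true w = c.
Proof.
elim: c => [|[n g] c IHc]; first by exists [::].
case/andP=> /= n0 /IHc[w pw rw]; set W := weight c in pw *.
pose u : word := [seq ((W + i)%N, g) | i <- iota 1 n].
have incu : inc g u.
  rewrite /u; elim: (n) 1%N => [|k IHk] i //=; rewrite eqxx IHk andbT /=.
  by apply/allP => _ /mapP[j + ->]; rewrite mem_iota leq_add2l /= => /andP[/ltnW].
have su : size u = n by rewrite size_map size_iota.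
have u0 : u != [::] by rewrite -size_eq0 su -lt0n.
exists (u ++ w).
  rewrite weight_cons addnC iotaD /unzip1 map_cat perm_catC perm_cat //.
  by rewrite add1n -addn1 iotaDl -map_comp.
case: w pw rw => [|z w] pw rw.
  by rewrite cats0 -rw (runs_inc u0 incu) su.
rewrite (runs_inc_cat _ _ u0 incu) rw su; case: ifP => // /negbT;
  rewrite negb_or => /andP[_].
have ult : all (fun l : nat * gT => W < l.1)%N u.
  by apply/allP => _ /mapP[j + ->]; rewrite mem_iota /=; lia.
have lu : last z u \in u by case: (u) u0 => // a s _; exact: (mem_last a s).
have /= lt := allP ult _ lu;
  have : z.1 \in iota 1 W by rewrite -(perm_mem pw) /= mem_head.
rewrite mem_iota add1n ltnS => /andP[_ le] /negP[]; exact: leq_ltn_trans lt.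
Qed.

Lemma DesG_exists c : is_Gcomp c -> exists a : wreath gT (weight c), DesG a = c.
Proof.
case/runs_exists => w /cw_surj[a Ea] rw; exists a.
by rewrite DesGE Ea.
Qed.
End RunsInc.

(** * The algebra Sigma(G) and the map Theta *)

Lemma scaled_sum_cat (K : fieldType) (V : lmodType K) (I : Type) (F : I -> V)
    (a : K) (s s' : seq (K * I)) :
  a *: (\sum_(p <- s) p.1 *: F p.2) + \sum_(p <- s') p.1 *: F p.2
  = \sum_(p <- [seq (a * p.1, p.2) | p <- s] ++ s') p.1 *: F p.2.
Proof.
rewrite big_cat big_map scaler_sumr /=; congr (_ + _).
by apply: eq_bigr => p _; rewrite scalerA.
Qed.

Section Span.
Variables (K : fieldType) (gT : finGroupType).
Local Notation word := (seq (nat * gT)).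
Local Notation KG := (KG K gT).
Local Notation cw := (@coloured_word gT _).
Implicit Types (x y : KG) (v c : seq (nat * gT)) (g : gT).

(** Every property proved on Sigma(G) is closed under linear combinations, so
    that it can be checked on a spanning family. *)
Definition subspace (P : KG -> Prop) :=
  P 0 /\ forall (a : K) x y, P x -> P y -> P (a *: x + y).

Lemma subspace_sum P (I : eqType) (r : seq I) (C : pred I) (a : I -> K) (F : I ->
  KG) :
  subspace P -> (forall i, i \in r -> C i -> P (F i)) ->
  P (\sum_(i <- r | C i) a i *: F i).
Proof.
move=> [P0 PD]; elim: r => [|i r IHr] PF; first by rewrite big_nil.
have PFr : P (\sum_(j <- r | C j) a j *: F j).
  by apply: IHr => j jr; apply: PF; rewrite inE jr orbT.
rewrite big_cons; case: ifP => // Ci; apply: PD => //.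
by apply: PF; rewrite ?mem_head.
Qed.

Lemma subspaceZ P a x : subspace P -> P x -> P (a *: x).
Proof. by move=> [P0 PD] Px; rewrite -[_ *: _]addr0; apply: PD. Qed.

Lemma subspaceD P x y : subspace P -> P x -> P y -> P (x + y).
Proof. by move=> [P0 PD] Px Py; rewrite -[x]scale1r; apply: PD. Qed.

Lemma subspaceB P x y : subspace P -> P x -> P y -> P (x - y).
Proof. by move=> [P0 PD] Px Py; rewrite addrC -scaleN1r; apply: PD. Qed.

Lemma subspace_preim (f : {linear KG -> KG}) P :
  subspace P -> subspace (fun x => P (f x)).
Proof.
move=> [P0 PD]; split=> [|a x y Px Py]; first by rewrite linear0.
by rewrite linearP; apply: PD.
Qed.

Lemma subspace_ker (V : lmodType K) (f f' : {linear KG -> V}) :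
  subspace (fun x => f x = f' x).
Proof. by split=> [|a x y E E']; rewrite ?linear0 // !linearP E E'. Qed.

Lemma in_span_subspace (F : seq (nat * gT) -> KG) : subspace (in_span F).
Proof.
split=> [|a x y [s sG ->] [s' s'G ->]]; first by exists [::]; rewrite ?big_nil.
exists ([seq (a * p.1, p.2) | p <- s] ++ s').
  by rewrite all_cat all_map s'G andbT.
exact: scaled_sum_cat.
Qed.

Lemma in_span_gen (F : seq (nat * gT) -> KG) c : is_Gcomp c -> in_span F (F c).
Proof.
by move=> cG; exists [:: (1, c)]; rewrite /= ?cG // big_seq1 scale1r.
Qed.

Lemma in_span_ind (F : seq (nat * gT) -> KG) P :
  subspace P -> (forall c, is_Gcomp c -> P (F c)) -> forall x, in_span F x -> P x.
Proof.
move=> PS PF _ [s /allP sG ->]; apply: subspace_sum => // p ps _.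
by apply: PF; apply: sG.
Qed.

Lemma dGE c : dG K c = word_sum (weight c) (fun w => (runs true w == c)%:R).
Proof.
rewrite /dG /word_sum big_mkcond; apply: eq_bigr => a _; rewrite DesGE.
by case: (_ == _); rewrite ?scale1r ?scale0r.
Qed.

Lemma pGE c : pG K c = word_sum (weight c) (fun w => (runs false w == c)%:R).
Proof.
rewrite /pG /word_sum big_mkcond; apply: eq_bigr => a _; rewrite PeakGE.
by case: (_ == _); rewrite ?scale1r ?scale0r.
Qed.

(** The product of the free generators d_(n)^g over the letters (n, g) of v.
    Sizes 0 are allowed and contribute a factor 1. *)
Definition hprod v : KG := block_sum (@incK K gT) v.

Lemma block_sum1 (phi : gT -> word -> K) n g :
  block_sum phi [:: (n, g)] = word_sum n (phi g).
Proof.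
have En : weight [:: (n, g)] = n by apply: addn0.
rewrite /block_sum En; apply: eq_word_sum => a.
rewrite block_coef_take ?size_cw //=.
by rewrite take_oversize ?drop_oversize ?size_cw // mulr1.
Qed.

Lemma hprod_cat v1 v2 : hprod (v1 ++ v2) = KGmul (hprod v1) (hprod v2).
Proof. exact/block_sum_cat/incK_inv. Qed.

(** The multiplication rule that links the d_c to the products of generators. *)
Lemma hprod_mul_dG n g c : (0 < n)%N -> is_Gcomp c ->
  KGmul (hprod [:: (n, g)]) (dG K c) =
  dG K ((n, g) :: c) +
  (if c is (m, h) :: c' then
     if g == h then dG K (((n + m)%N, g) :: c') else 0
   else 0).
Proof.
move=> n0 cG; rewrite /hprod block_sum1 dGE KGmul_word_sum; first last.
- by move=> f w fM; rewrite runs_inv.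
- exact: incK_inv.
transitivity (word_sum (n + weight c) (fun w => (runs true w == (n, g) :: c)%:R : K)
  + word_sum (n + weight c) (fun w =>
   (if c is (m, h) :: c' then (g == h) && (runs true w == ((n + m)%N, g) :: c')
    else false)%:R : K)).
  rewrite /word_sum -big_split /=; apply: eq_bigr => a _; rewrite -scalerDl.
  congr (_ *: _); rewrite -natrM mulnb -natrD; congr _%:R.
  by rewrite inc_runs_split ?size_cw.
congr (_ + _); first by rewrite dGE.
case: c {cG} => [|[m h] c].
  by rewrite /word_sum big1 // => a _; rewrite scale0r.
case: eqP => _ /=; last by rewrite /word_sum big1 // => a _; rewrite scale0r.
by rewrite dGE !weight_cons addnA.
Qed.

Lemma block_sum0 (phi : gT -> word -> K) g v :
  (forall g, phi g [::] = 1) -> block_sum phi ((0%N, g) :: v) = block_sum phi v.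
Proof.
move=> phi1; apply: eq_word_sum => a.
by rewrite block_coef_take // take0 drop0 phi1 mul1r.
Qed.

Lemma dG_nil : dG K [::] = KGone K gT.
Proof.
rewrite -(block_sum_nil (@incK K gT)) dGE; apply: eq_word_sum => a.
by rewrite (size0nil (size_cw a)).
Qed.

Lemma Sigma_mul_hprod n g x : (0 < n)%N -> Sigma x ->
  Sigma (KGmul (hprod [:: (n, g)]) x).
Proof.
move=> n0; move: x; apply: in_span_ind => [|c cG].
  exact: (subspace_preim (KGmul _) (in_span_subspace _)).
rewrite hprod_mul_dG //; apply: subspaceD; first exact: in_span_subspace.
  by apply: in_span_gen; rewrite /= n0.
have S0 : Sigma (0 : KG) by case: (in_span_subspace (dG K)).
case: c cG => // -[m h] c /= /andP[m0 cG]; case: eqP => // _.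
by apply: in_span_gen; rewrite /= cG andbT addn_gt0 n0.
Qed.

Lemma Sigma_hprod v : Sigma (hprod v).
Proof.
elim: v => [|[n g] v IHv].
  by rewrite /hprod block_sum_nil -dG_nil; apply: in_span_gen.
case: n => [|n]; first by rewrite /hprod block_sum0.
by rewrite -cat1s hprod_cat; apply: Sigma_mul_hprod.
Qed.

(** The products of the generators span Sigma(G): solve the multiplication rule
    for the composition with more parts, and induct on the number of parts. *)
Lemma Sigma_ind P : subspace P -> (forall v, P (hprod v)) ->
  forall x, Sigma x -> P x.
Proof.
move=> PS PH; apply: in_span_ind => // c cG.
have [k] := ubnP (size c); elim: k c cG P PS PH => // k IHk [|[n g] c] /=.
  by move=> _ P PS PH _; rewrite dG_nil -(block_sum_nil (@incK K gT)).
move=> /andP[n0 cG] P PS PH lt.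
have -> : dG K ((n, g) :: c) = KGmul (hprod [:: (n, g)]) (dG K c) -
    (if c is (m, h) :: c' then
     if g == h then dG K (((n + m)%N, g) :: c') else 0 else 0).
  by rewrite hprod_mul_dG // addrK.
apply: subspaceB => //.
  have Hs : subspace (fun x => P (KGmul (hprod [:: (n, g)]) x)).
    exact: (subspace_preim (KGmul _)).
  have Hh v : P (KGmul (hprod [:: (n, g)]) (hprod v)) by rewrite -hprod_cat.
  exact: (IHk c cG _ Hs Hh lt).
case: c lt cG => [|[m h] c] /= lt; first by case: PS.
case/andP=> m0 cG; case: eqP => _; last by case: PS.
by apply: IHk; rewrite //= cG addn_gt0 n0.
Qed.

End Span.

Section Theta.
Variables (K : fieldType) (gT : finGroupType).
Hypothesis charK : [pchar K] =i pred0.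
Local Notation word := (seq (nat * gT)).
Local Notation KG := (KG K gT).
Local Notation cw := (@coloured_word gT _).
Implicit Types (x y : KG) (v c : seq (nat * gT)) (g : gT).

(** The products of the elements 2 p_(n)^g, the intended images of hprod. *)
Definition vprod v : KG := block_sum (@veeK K gT) v.

Lemma vprod_cat v1 v2 : vprod (v1 ++ v2) = KGmul (vprod v1) (vprod v2).
Proof. exact/block_sum_cat/veeK_inv. Qed.

Lemma vprod_nil : vprod [::] = KGone K gT. Proof. exact: block_sum_nil. Qed.

(** The multiplication rule for d_(n)^g * d_c, solved for the longer
    composition, determines the image of d_((n, g) :: c). *)
Fixpoint theta_comp n g c : KG :=
  if c is (m, h) :: c' then
    KGmul (vprod [:: (n, g)]) (theta_comp m h c')
      - (if g == h then theta_comp (n + m) g c' else 0)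
  else vprod [:: (n, g)].

Definition theta_dG c : KG :=
  if c is (n, g) :: c' then theta_comp n g c' else KGone K gT.

(** The d_c are sums over disjoint nonempty classes.  Spreading the image of
    d_c evenly over its class defines a linear map on K[G] with the prescribed
    values, without having to choose a complement of Sigma(G). *)
Definition theta_bas (a : Gpt gT) : KG :=
  (#|[pred b : wreath gT (tag a) | DesG b == DesG (tagged a)]|%:R)^-1
    *: theta_dG (DesG (tagged a)).

Definition theta : KG -> KG := lin_ext theta_bas.
HB.instance Definition _ := GRing.Linear.copy theta (lin_ext theta_bas).

Lemma natr_neq0 n : (0 < n)%N -> (n%:R : K) != 0.
Proof. by rewrite ((pcharf0P K).1 charK) lt0n. Qed.

Lemma theta_dGE c : is_Gcomp c -> theta (dG K c) = theta_dG c.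
Proof.
case/DesG_exists => a0 Ea0; rewrite /dG linear_sum /=.
pose N := #|[pred b : wreath gT (weight c) | DesG b == c]|.
rewrite (eq_bigr (fun=> N%:R^-1 *: theta_dG c)) => [|a /eqP Ea]; last first.
  by rewrite /theta /bas lin_extU /theta_bas /= Ea.
rewrite sumr_const -/N -scaler_nat scalerA divff ?scale1r //.
by apply: natr_neq0; apply/card_gt0P; exists a0; rewrite inE Ea0.
Qed.

Lemma theta_mul_hprod n g x : (0 < n)%N -> Sigma x ->
  theta (KGmul (hprod K [:: (n, g)]) x) = KGmul (vprod [:: (n, g)]) (theta x).
Proof.
move=> n0; move: x; apply: in_span_ind => [|c cG].
  exact: (subspace_ker (theta \o KGmul (hprod K [:: (n, g)]))
                       (KGmul (vprod [:: (n, g)]) \o theta)).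
have cG' : is_Gcomp ((n, g) :: c) by rewrite /= n0.
rewrite hprod_mul_dG // linearD /= (theta_dGE cG) (theta_dGE cG') /=.
case: c cG {cG'} => [|[m h] c] /= cG;
  first by rewrite [theta 0]linear0 addr0 -vprod_nil -vprod_cat cats0.
case: eqP => _; last by rewrite [theta 0]linear0 subr0 addr0.
by rewrite theta_dGE ?subrK //= addn_gt0 n0; case/andP: cG.
Qed.

(** The recursion that defines theta on the d_c makes it multiplicative for the
    product with a generator. *)
Lemma theta_hprod v : theta (hprod K v) = vprod v.
Proof.
elim: v => [|[n g] v IHv].
  by rewrite /hprod block_sum_nil -dG_nil theta_dGE // vprod_nil.
case: n => [|n]; first by rewrite /hprod /vprod !block_sum0 // => h;
  apply: (veeK_char _ _).1.
rewrite -cat1s hprod_cat theta_mul_hprod ?IHv ?vprod_cat //; exact: Sigma_hprod.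
Qed.

End Theta.

(** * Sums over descent classes and peak classes *)

Section ClassSpans.
Variable gT : finGroupType.
Local Notation word := (seq (nat * gT)).
Local Notation cw := (@coloured_word gT _).
Implicit Types (w : word) (g h : gT) (c v : seq (nat * gT)) (l : seq (bool * gT)).

(** The first letter is marked as a break, so that each part of a composition
    starts with a mark. *)
Definition full_flags t w : seq (bool * gT) :=
  if w is x :: w' then (true, x.2) :: flags t t x w' else [::].

(** The list of flags from which a composition is read off. *)
Definition expand c : seq (bool * gT) :=
  flatten [seq (true, p.2) :: nseq p.1.-1 (false, p.2) | p <- c].

(** Colours only change at breaks; this is what makes cut_blocks injective. *)
Fixpoint unbroken g l : bool :=
  if l is (b, h) :: l' then (b || (g == h)) && unbroken h l' else true.

Lemma flags_unbroken t up x w : unbroken x.2 (flags t up x w).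
Proof.
elim: w x up => [|y w IHw] x up //=; rewrite IHw andbT.
by case: eqP => //=; rewrite orbT.
Qed.

Lemma expand_cut_blocks n g l : unbroken g l ->
  expand (cut_blocks n.+1 g l) = (true, g) :: nseq n (false, g) ++ l.
Proof.
elim: l n g => [|[b h] l IHl] n g /=; first by rewrite /expand /= !cats0.
case: b => [/IHl E|/andP[/eqP <- /IHl E]];
  first by rewrite /expand /= -/(expand _) E.
by rewrite E -[nseq n.+1 _]/(nseq (1 + n) _) addnC nseqD /= -catA.
Qed.

Lemma expand_runs t w : expand (runs t w) = full_flags t w.
Proof. by case: w => // x w; rewrite /= expand_cut_blocks ?flags_unbroken. Qed.

Lemma full_flags_runs t w w' :
  full_flags t w = full_flags t w' -> runs t w = runs t w'.
Proof. by case: w w' => [|x w] [|x' w'] //= [-> ->]. Qed.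

(** Compositions and lists of flags carry the same information. *)
Lemma runs_full_flags t w w' :
  runs t w = runs t w' -> full_flags t w = full_flags t w'.
Proof. by move=> E; rewrite -!expand_runs E. Qed.

Lemma size_flags t up x w : size (flags t up x w) = size w.
Proof. by elim: w x up => [|y w IHw] x up //=; rewrite IHw. Qed.

Lemma weight_cut_blocks n g l : weight (cut_blocks n g l) = (n + size l)%N.
Proof.
elim: l n g => [|[[] h] l IHl] n g //=.
  by rewrite weight_cons IHl add1n.
by rewrite IHl addSnnS.
Qed.

Lemma weight_runs t w : weight (runs t w) = size w.
Proof. by case: w => // x w; rewrite weight_cut_blocks size_flags. Qed.

Lemma is_Gcomp_runs t w : is_Gcomp (runs t w).
Proof.
have H l n g : (0 < n)%N -> is_Gcomp (cut_blocks n g l).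
  by elim: l n g => [|[[] h] l IHl] n g n0 /=; rewrite ?n0 ?IHl.
by case: w => // x w; apply: H.
Qed.

Section ClassSums.
Variables (K : fieldType) (t : bool).

Definition class_sum c : KG K gT :=
  word_sum (weight c) (fun w => (runs t w == c)%:R).

Definition class_rep n c : wreath gT n :=
  odflt 1%g [pick a : wreath gT n | runs t (cw a) == c].

Definition class_list n : seq (seq (nat * gT)) :=
  undup [seq runs t (cw a) | a : wreath gT n].

Lemma class_listP n c : c \in class_list n -> runs t (cw (class_rep n c)) = c.
Proof.
rewrite mem_undup => /mapP[a _ ->]; rewrite /class_rep.
by case: pickP => [b /eqP //|/(_ a)]; rewrite eqxx.
Qed.

Lemma word_sum_classes n (F : word -> K) :
  (forall a b : wreath gT n, runs t (cw a) = runs t (cw b) ->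
    F (cw a) = F (cw b)) ->
  word_sum n F = \sum_(c <- class_list n) F (cw (class_rep n c)) *: class_sum c.
Proof.
move=> FE; rewrite /word_sum.
transitivity (\sum_(c <- class_list n) \sum_(a : wreath gT n)
   (F (cw (class_rep n c)) * (runs t (cw a) == c)%:R) *: bas K a).
  rewrite exchange_big; apply: eq_bigr => a _ /=; rewrite -scaler_suml.
  have ac : runs t (cw a) \in class_list n.
    by rewrite mem_undup; apply: image_f.
  congr (_ *: _); rewrite (bigD1_seq (runs t (cw a))) ?undup_uniq //= eqxx mulr1.
  rewrite big1 ?addr0 => [|c neq]; last by rewrite eq_sym (negbTE neq) mulr0.
  by apply: FE; rewrite class_listP.
rewrite big_seq [RHS]big_seq; apply: eq_bigr => c cl.
rewrite /class_sum; have -> : weight c = n.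
  by rewrite -(class_listP cl) weight_runs size_cw.
by rewrite scaler_sumr; apply: eq_bigr => a _; rewrite scalerA.
Qed.

Lemma word_sum_in_span n (F : word -> K) :
  (forall a b : wreath gT n, runs t (cw a) = runs t (cw b) ->
    F (cw a) = F (cw b)) ->
  in_span class_sum (word_sum n F).
Proof.
move=> FE; rewrite word_sum_classes //; apply: subspace_sum => [|c cl _].
  exact: in_span_subspace.
by apply: in_span_gen; rewrite -(class_listP cl) is_Gcomp_runs.
Qed.

End ClassSums.

(** After an ascent every descent is a peak, so having no break means
    increasing. *)
Lemma inc_flagsE g x w : uniq (unzip1 (x :: w)) ->
  inc g (x :: w) = (x.2 == g) && all (pred1 (false, g)) (flags false true x w).
Proof.
elim: w x => [|y w IHw] x //; rewrite [uniq _]/= inE negb_or -andbA.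
move=> /and3P[nxy xw yw]; have {}IHw := IHw y yw.
have -> : inc g [:: x, y & w] = [&& x.2 == g, (x.1 <= y.1)%N & inc g (y :: w)].
  rewrite /= !andbA; case: (x.2 == g) => //=; case: (y.2 == g);
    rewrite ?andbF //= !andbT.
  case: (leqP x.1 y.1) => //= xy;
    case: (boolP (all (fun b => y.1 <= b.1)%N w)) => [H|]; last by rewrite andbF.
  by rewrite (sub_all _ H) // => b; apply: leq_trans.
rewrite IHw [flags _ _ _ (_ :: _)]/= [all _ (_ :: _)]/= /pred1 /= xpair_eqE.
have [<-|] := eqVneq x.2 g => //=.
have [yg|] := eqVneq y.2 x.2; rewrite ?yg ?eqxx ?andbF //= andbT.
by have [lt|//|E] := ltngtP x.1 y.1; [ | rewrite E eqxx in nxy].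
Qed.

Lemma vee_flags g x w : uniq (unzip1 (x :: w)) ->
  vee g (x :: w) = (x.2 == g) && all (pred1 (false, g)) (flags false false x w).
Proof.
elim: w x => [|y w IHw] x //; rewrite [uniq _]/= inE negb_or -andbA.
move=> /and3P[nxy xw yw]; have {}IHw := IHw y yw.
have incE := inc_flagsE g yw.
have -> : vee g [:: x, y & w] =
  (x.2 == g) && (if (y.1 < x.1)%N then vee g (y :: w) else inc g (y :: w)) by [].
rewrite IHw incE [flags _ _ _ (_ :: _)]/= [all _ (_ :: _)]/= /pred1 /= xpair_eqE
  orbF.
have [<-|] := eqVneq x.2 g => //=.
have [yg|] := eqVneq y.2 x.2; rewrite ?yg ?eqxx ?andbF //=; last by case: ifP.
by have [lt|//|E] := ltngtP x.1 y.1; [ | rewrite E eqxx in nxy].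
Qed.

(** The words of V shape are those without interior peak, so that the one block
    case of veeK is 2 p_(n)^g. *)
Lemma vee_runs g w : uniq (unzip1 w) -> w != [::] ->
  vee g w = (runs false w == [:: (size w, g)]).
Proof.
case: w => // x w uw _; rewrite vee_flags //; apply/andP/eqP => [[/eqP xg]|E].
  move/all_pred1P; rewrite size_flags => E.
  rewrite [runs _ _]/= E xg -[nseq _ _]cats0 cut_blocks_nseq.
  by rewrite add1n.
have := expand_runs false (x :: w); rewrite E /expand /= cats0 => -[<- <-].
by split; rewrite ?eqxx ?all_pred1_nseq.
Qed.
End ClassSpans.

(** * Peak classes occurring in a product of V-shaped sums *)

Section Measure.

Fixpoint tail_weight (s : seq bool) : nat :=
  if s is b :: s' then (b * (size s').+1 + tail_weight s')%N else 0%N.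

(** If every element of q is an element of p or the successor of one, and an
    element of q outside p never follows another element of q, then sending
    elements of q into p by moving some of them one step back is injective and
    increases weights.  Hence q weighs at most as much as p, with equality only
    if q = p.  In the recursion pp and pq tell whether the preceding position
    is in p and in q; an unused element of p there is worth size p. *)
Lemma tail_weight_le (q p : seq bool) pp pq :
  size q = size p ->
  (forall i, nth false q i -> nth false p i || nth false (pp :: p) i) ->
  (forall i, nth false q i -> ~~ nth false p i -> ~~ nth false (pq :: q) i) ->
  (tail_weight q <= tail_weight p + (pp && ~~ pq) * size p)%N /\
  (~~ (pp && ~~ pq) -> tail_weight q = tail_weight p -> q = p).
Proof.
elim: p q pp pq => [|b p IHp] [|a q] pp pq //= [sz] H1 H2.
have [IH1 IH2] := IHp q b a sz (fun i => H1 i.+1) (fun i => H2 i.+1).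
have := H1 0%N; have := H2 0%N; move: IH1 IH2; rewrite /= sz.
case: a {H1 H2}; case: b => /=; rewrite ?mul1n ?mul0n ?addn0 ?add0n.
- move=> IH1 IH2 _ _; split; first by lia.
  by move=> _ E; rewrite IH2 //; lia.
- move=> IH1 IH2 /(_ isT isT) /negbTE-> /(_ isT) ->; split=> //=; lia.
- by move=> IH1 IH2 _ _; split; [|move=> _ E]; lia.
move=> IH1 IH2 _ _; split; first by lia.
by move=> _ E; rewrite IH2.
Qed.
End Measure.

Section PeakCoef.
Variables (K : fieldType) (gT : finGroupType).
Local Notation word := (seq (nat * gT)).
Local Notation cw := (@coloured_word gT _).
Implicit Types (w : word) (g h : gT) (c v : seq (nat * gT)) (l : seq (bool * gT)).

(** block_coef for veeK, computed from flags.  Within a block only the marks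
    from the third letter on matter: the mark of the second letter of a block,
    if it is not a colour change, is a peak at the first letter of the block,
    which V shape does not exclude. *)
Fixpoint peak_coef v l : K :=
  if v is (n, g) :: v' then
    (if n == 0%N then 1 else
     2 * (all (pred1 g) (unzip2 (take n l))
          && all negb (unzip1 (drop 2 (take n l))))%:R)
    * peak_coef v' (drop n l)
  else 1.

(** Equality up to the first two marks, which are the ones that change when a
    word is cut: a peak at the start of the right factor becomes invisible. *)
Definition similar l l' := unzip2 l = unzip2 l' /\ drop 2 l = drop 2 l'.

Lemma flags_take t up x n w : flags t up x (take n w) = take n (@flags gT t up x w).
Proof. by elim: w x up n => [|y w IHw] x up [|n] //=; rewrite IHw. Qed.

Lemma full_flags_take t n w : full_flags t (take n w) = take n (full_flags t w).
Proof. by case: w n => [|x w] [|n] //=; rewrite flags_take. Qed.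

Lemma full_flags_drop n w :
  drop 2 (drop n (full_flags false w)) = drop 2 (full_flags false (drop n w)).
Proof.
have D u : drop 3 (full_flags false u) = drop 2 (full_flags false (behead u)).
  by case: u => [|x [|y [|z u]]].
elim: n w => [|n IHn] w; first by rewrite !drop0.
have -> : drop n.+1 w = drop n (behead w) by case: w => // x w;
  rewrite /= drop_oversize.
rewrite -IHn drop_drop addnS -addSn -[X in drop X]addnC -drop_drop D.
by rewrite !drop_drop addnC.
Qed.

Lemma unzip2_full_flags t w : unzip2 (full_flags t w) = unzip2 w.
Proof.
case: w => // x w; congr (_ :: _); rewrite -/(unzip2 _) -[RHS]/(unzip2 w).
by elim: w x {2}t => [|y w IHw] x up //=; rewrite IHw.
Qed.

Lemma size_full_flags t w : size (full_flags t w) = size w.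
Proof. by case: w => // x w; rewrite /= size_flags. Qed.

Lemma vee_full g w : uniq (unzip1 w) ->
  vee g w = all (pred1 g) (unzip2 (full_flags false w))
            && all negb (unzip1 (drop 2 (full_flags false w))).
Proof.
have split_all l : all (pred1 (false, g)) l =
    all (pred1 g) (unzip2 l) && all negb (unzip1 l).
  rewrite !all_map -all_predI; apply: eq_all => -[b h] /=.
  by rewrite xpair_eqE andbC; case: b.
case: w => // x w uw; rewrite vee_flags //=.
have [Eg|] := eqVneq x.2 g => //=.
case: w {uw} => // y w /=; rewrite drop0 /= xpair_eqE orbF split_all Eg.
by rewrite [y.2 == g]eq_sym; case: (g == y.2).
Qed.

Lemma similar_take n l l' : similar l l' -> similar (take n l) (take n l').
Proof.
case=> E2 Ed; split; first by rewrite /unzip2 !map_take -/(unzip2 _) E2.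
case: n => [|[|n]]; rewrite ?take0 //.
  by case: l l' {E2 Ed} => [|? ?] [|? ?]; rewrite /= ?take0.
by rewrite -[n.+2]addn2 -!take_drop Ed.
Qed.

Lemma similar_drop n l l' : similar l l' -> similar (drop n l) (drop n l').
Proof.
case=> E2 Ed; split; first by rewrite /unzip2 !map_drop -/(unzip2 _) E2.
by rewrite !drop_drop addnC -!drop_drop Ed.
Qed.

Lemma similar_full_drop n w l : similar l (full_flags false w) ->
  similar (drop n l) (full_flags false (drop n w)).
Proof.
move/(similar_drop n) => [E2 Ed]; split; last by rewrite Ed full_flags_drop.
by rewrite E2 /unzip2 map_drop -!/(unzip2 _) !unzip2_full_flags /unzip2 map_drop.
Qed.

Lemma uniq_take_drop n w : uniq (unzip1 w) ->
  uniq (unzip1 (take n w)) /\ uniq (unzip1 (drop n w)).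
Proof.
rewrite -{1}(cat_take_drop n w) /unzip1 map_cat cat_uniq.
by case/and3P.
Qed.

(** In particular the coefficient of w in vprod v depends only on the peak
    composition of w. *)
Lemma block_coef_veeK v w l : size w = weight v -> uniq (unzip1 w) ->
  similar l (full_flags false w) ->
  block_coef (@veeK K gT) v w = peak_coef v l.
Proof.
elim: v w l => [|[n g] v IHv] w l; first by move/size0nil->.
rewrite weight_cons => sz uw sim; have [ut ud] := uniq_take_drop n uw.
rewrite block_coef_take ?sz ?leq_addr // (IHv _ (drop n l)) //; last 2 first.
- by rewrite size_drop sz addKn.
- exact: similar_full_drop.
rewrite [peak_coef _ _]/=; congr (_ * _); case: eqP => [->|/eqP n0].
  by rewrite take0; apply: (veeK_char _ _).1.
have st : size (take n w) = n by rewrite size_takel // sz leq_addr.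
have [E2 Ed] := similar_take n sim; rewrite E2 Ed -full_flags_take -vee_full //.
by case: (take n w) st n0 => [<-|x u _ _] //; rewrite veeK_vee.
Qed.

Lemma expand_cons n g v : (0 < n)%N ->
  expand ((n, g) :: v) = ((true, g) :: nseq n.-1 (false, g)) ++ expand v.
Proof. by []. Qed.

Lemma expand_head v : is_Gcomp v -> (0 < weight v)%N ->
  nth false (unzip1 (expand v)) 0.
Proof. by case: v => // -[n g] v /= /andP[/= n0 _] _. Qed.

(** A block admits peaks only at its first and at its last letter.  So every
    break of l is a break of v or comes right after one. *)
Lemma peak_coef_dominated v l : is_Gcomp v -> size l = weight v ->
  peak_coef v l != 0 ->
  unzip2 l = unzip2 (expand v) /\
  forall i, (1 < i)%N -> nth false (unzip1 l) i ->
    nth false (unzip1 (expand v)) i || nth false (unzip1 (expand v)) i.-1.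
Proof.
elim: v l => [|[n g] v IHv] l.
  by move=> _ /size0nil-> _; split=> // i _; rewrite nth_nil.
rewrite [is_Gcomp _]/= => /andP[n0 vG] sz.
rewrite [peak_coef _ _]/= gtn_eqF //.
rewrite mulf_eq0 negb_or => /andP[neq0 neq0'].
have sd : size (drop n l) = weight v by rewrite size_drop sz weight_cons addKn.
have [E2 dom] := IHv _ vG sd neq0'.
have {neq0 neq0'} /andP[cg np] :
    all (pred1 g) (unzip2 (take n l)) && all negb (unzip1 (drop 2 (take n l))).
  by move: neq0; case: (_ && _); rewrite ?mulr0 ?eqxx.
have st : size (take n l) = n by rewrite size_takel // sz weight_cons leq_addr.
rewrite expand_cons //; set B := (_ :: _).
have sB : size B = n by rewrite /= size_nseq prednK.
have E2B : unzip2 (take n l) = unzip2 B.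
  move/all_pred1P: cg; rewrite size_map st => ->.
  by rewrite /B -(prednK n0) /unzip2 /= map_nseq.
split=> [|i i1].
  by rewrite -[l in LHS](cat_take_drop n) /unzip2 !map_cat -!/(unzip2 _) E2B E2.
rewrite -[l in nth _ (unzip1 l)](cat_take_drop n) /unzip1 !map_cat !nth_cat
  !size_map st sB.
have [lt|le] := ltnP i n.
  move=> qi; move/(all_nthP false)/(_ (i - 2)%N): np.
  rewrite size_map size_drop st; have -> : (i - 2 < n - 2)%N by lia.
  rewrite /unzip1 map_drop nth_drop subnKC // => /(_ isT).
  by rewrite qi.
case: (posnP (weight v)) => [w0|wpos].
  have -> : drop n l = [::] by apply: size0nil; rewrite sd.
  by rewrite nth_nil.
have h0 := expand_head vG wpos; rewrite /unzip1 in h0 dom.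
(* Position n starts the next block, hence is a break of v; this settles
   the positions n and n.+1. *)
case: (ltngtP i n.+1) => [lt|gt|->].
- have -> : i = n by lia.
  by rewrite subnn h0.
- have -> : (i.-1 - n)%N = (i - n).-1 by lia.
  have /negbTE-> : ~~ (i.-1 < n)%N by lia.
  by apply: dom; lia.
- by move=> _; rewrite /= ltnn subnn h0 orbT.
Qed.

Lemma peak_coef_expand v : [pchar K] =i pred0 -> is_Gcomp v ->
  peak_coef v (expand v) != 0.
Proof.
move=> charK; elim: v => [|[n g] v IHv]; first by rewrite oner_eq0.
rewrite [is_Gcomp _]/= => /andP[n0 vG].
rewrite [peak_coef _ _]/= gtn_eqF // expand_cons //; set B := (_ :: _).
have sB : size B = n by rewrite /= size_nseq prednK.
rewrite take_size_cat // drop_size_cat // mulf_neq0 ?IHv //.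
have -> : all (pred1 g) (unzip2 B).
  by rewrite /B /= eqxx /unzip2 map_nseq all_pred1_nseq.
have -> : all negb (unzip1 (drop 2 B)).
  rewrite /B /=; case: n.-1 => //= k; rewrite drop0 /unzip1 map_nseq.
  by elim: k.
by rewrite mulr1 ((pcharf0P K).1 charK).
Qed.

Lemma unbroken_nth g l i d : unbroken g l -> (i < size l)%N ->
  ~~ nth false (unzip1 l) i -> nth d (g :: unzip2 l) i.+1 = nth d (g :: unzip2 l) i.
Proof.
elim: l g i => [|[b h] l IHl] g [|i] //= /andP[bg ub] lt.
  by move/negbTE => b0; move: bg; rewrite b0 => /eqP.
exact: IHl.
Qed.

(** Peaks are never adjacent: a peak needs an ascent just before it. *)
Lemma flags_nonadjacent (x : nat * gT) w (up b : bool) i d : (up -> ~~ b) ->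
  (i < size w)%N ->
  nth false (unzip1 (flags false up x w)) i ->
  nth d (unzip2 (x :: w)) i.+1 = nth d (unzip2 (x :: w)) i ->
  ~~ nth false (b :: unzip1 (flags false up x w)) i.
Proof.
elim: w x up b i => [|y w IHw] x up b [|i] //= upb lt.
  by case: (x.2 =P y.2) => /= [_ /andP[/upb]|neq _ E] //; case: neq.
move=> ti E; apply: (IHw y) => //.
by case/andP=> /eqP-> xy; rewrite eqxx /= negb_and -leqNgt (ltnW xy) orbT.
Qed.

(** Let P be the breaks of w0 and Q those of w.  A nonzero coefficient forces
    Q to be contained in the union of P and P + 1, and the elements of Q
    outside P are peaks, so they do not follow another element of Q.  Then
    tail_weight_le compares the two sets. *)
Lemma peak_coef_triangular w w0 : uniq (unzip1 w) -> size w = size w0 ->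
  block_coef (@veeK K gT) (runs false w0) w != 0 ->
  runs false w = runs false w0 \/
  (tail_weight (unzip1 (full_flags false w)) < tail_weight (unzip1 (full_flags
    false w0)))%N.
Proof.
move=> uw sz;
  rewrite (@block_coef_veeK _ _ (full_flags false w)) ?weight_runs // => neq0.
have [] := peak_coef_dominated (is_Gcomp_runs _ _) _ neq0.
  by rewrite size_full_flags weight_runs.
rewrite expand_runs => E2 dom.
set q := unzip1 (full_flags false w); set p := unzip1 (full_flags false w0).
have sqp : size q = size p by rewrite !size_map !size_full_flags.
have p0 i : nth false q i -> nth false p 0.
  case: (ltnP i (size q)) => [|le]; last by rewrite nth_default.
  by rewrite sqp /p; case: (w0).
have H1 i : nth false q i -> nth false p i || nth false (false :: p) i.
  by case: i => [|[|i]] qi; rewrite /= ?(p0 _ qi) ?orbT //; apply: dom.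
(* Colour changes of w are breaks of w0, so an element of q outside p is a
   peak of w. *)
have H2 i : nth false q i -> ~~ nth false p i -> ~~ nth false (false :: q) i.
  case: i => [|k] //; rewrite /q /p;
    case: w sz uw E2 {neq0 dom q p sqp p0 H1} => [|x u].
    by rewrite nth_nil.
  case: (w0) => [|x0 u0] // [sz] _ E2 qk pk.
  have ltk : (k < size u)%N.
    rewrite ltnNge; apply: contraL qk => le.
    by rewrite nth_default // size_map /= size_flags ltnS.
  have E := @unbroken_nth _ _ k x.2 (flags_unbroken false false x0 u0).
  rewrite size_flags -sz in E; have {E} := E ltk pk.
  rewrite -[_ :: _]/(unzip2 (full_flags false (x0 :: u0))) -E2 unzip2_full_flags
    => E.
  exact: (@flags_nonadjacent _ _ false true _ x.2 _ ltk qk E).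
have [le eq] := tail_weight_le sqp H1 H2; rewrite mul0n addn0 in le.
have [eqm|] := eqVneq (tail_weight q) (tail_weight p); last by move=> neq; right;
  rewrite ltn_neqAle neq.
left; apply: full_flags_runs.
rewrite -[LHS]zip_unzip -[RHS]zip_unzip E2 -/q -/p.
by rewrite (eq isT eqm).
Qed.
End PeakCoef.

(** * Theta is a Hopf morphism *)

Section HopfMorphism.
Variables (K : fieldType) (gT : finGroupType).
Local Notation word := (seq (nat * gT)).
Local Notation KG := (KG K gT).
Local Notation KG2 := (KG2 K gT).
Local Notation cw := (@coloured_word gT _).
Local Notation hprod := (hprod K).
Local Notation vprod := (@vprod K gT).
Local Notation theta := (@theta K gT).
Implicit Types (x y : KG) (v c : seq (nat * gT)) (g : gT) (f S : {linear KG -> KG}).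

Lemma in_span_ext (F F' : seq (nat * gT) -> KG) x :
  (forall c, F c = F' c) -> in_span F x -> in_span F' x.
Proof.
move=> E [s sG ->]; exists s => //.
by apply: eq_bigr => p _; rewrite E.
Qed.

(** V shape read off the descents: a word has V shape exactly when no ascent
    precedes a descent. *)
Fixpoint vee_des g (l : seq (bool * gT)) : bool :=
  if l is (b, h) :: l' then
    (h == g) && (if b then vee_des g l' else all (pred1 (false, g)) l')
  else true.

Lemma inc_des g (z : nat * gT) (w : word) :
  inc g (z :: w) = (z.2 == g) && all (pred1 (false, g)) (flags true true z w).
Proof.
apply/idP/andP => [/(flags_inc true)[-> ->]|]; first by rewrite eqxx all_pred1_nseq.
case=> /eqP zg /all_pred1P E.
have R : runs true (z :: w) = [:: ((1 + size w)%N, g)].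
  by rewrite [LHS]/= zg E size_flags -[nseq _ _]cats0 cut_blocks_nseq.
by have := runs_head_inc R (leqnn _); rewrite take_oversize.
Qed.

Lemma vee_desE g (z : nat * gT) (w : word) :
  vee g (z :: w) = (z.2 == g) && vee_des g (flags true true z w).
Proof.
elim: w z => [|y w IHw] z //.
have -> : vee g [:: z, y & w] =
  (z.2 == g) && (if (y.1 < z.1)%N then vee g (y :: w) else inc g (y :: w)) by [].
rewrite IHw inc_des /=; have [<-|] := eqVneq z.2 g => //=.
by have [->|] := eqVneq z.2 y.2; rewrite /= ?eqxx //; case: ifP.
Qed.

(** Whether a word has V shape is determined by its descents, so 2 p_(n)^g is
    constant on descent classes. *)
Lemma Sigma_vprod1 n g : Sigma (vprod [:: (n, g)]).
Proof.
rewrite /vprod block_sum1; apply: (@in_span_ext (class_sum K true)) => [c|].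
  by rewrite dGE.
apply: word_sum_in_span => a b /runs_full_flags.
have sa : size (cw a) = n := size_cw a; have sb : size (cw b) = n := size_cw b.
case: (cw a) sa => [|z w] sa; case: (cw b) sb => [|z' w'] sb //.
by case=> Ex Ef; rewrite !veeK_vee !vee_desE Ex Ef.
Qed.

(** The product as a linear function of its left argument. *)
Definition KGmulr y x := KGmul x y.

Lemma KGmulr_linear y : linear (KGmulr y).
Proof.
move=> a x1 x2; rewrite /KGmulr /KGmul (tensor_linl y a x1 x2).
exact: (linearP (@mul_tensor K gT : {linear _ -> _})).
Qed.
HB.instance Definition _ y :=
  GRing.isLinear.Build K KG KG *:%R (KGmulr y) (KGmulr_linear y).

Lemma Sigma_subspace : subspace (@Sigma gT K).
Proof. exact: in_span_subspace. Qed.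

Lemma Sigma_mul x y : Sigma x -> Sigma y -> Sigma (KGmul x y).
Proof.
move=> xS yS.
apply: (Sigma_ind (subspace_preim (KGmulr y) Sigma_subspace) _ xS) => v.
apply: (Sigma_ind (subspace_preim (KGmul (hprod v)) Sigma_subspace) _ yS) => v'.
by rewrite /= -hprod_cat; apply: Sigma_hprod.
Qed.

Lemma Sigma_vprod v : Sigma (vprod v).
Proof.
elim: v => [|[n g] v IHv].
  by rewrite vprod_nil -(block_sum_nil (@incK K gT)); apply: Sigma_hprod.
by rewrite -cat1s vprod_cat; apply: Sigma_mul; first exact: Sigma_vprod1.
Qed.

Lemma pG_vprod n g : (0 < n)%N -> vprod [:: (n, g)] = 2 *: pG K [:: (n, g)].
Proof.
move=> n0; rewrite /vprod block_sum1 pGE /word_sum scaler_sumr.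
have -> : weight [:: (n, g)] = n by apply: addn0.
apply: eq_bigr => a _; rewrite scalerA; congr (_ *: _).
have sa := size_cw a; have ua := uniq_cw a.
have w0 : cw a != [::] by rewrite -size_eq0 sa -lt0n.
have := vee_runs g ua w0; rewrite sa => <-.
by case: (cw a) w0 => // z w _; apply: veeK_vee.
Qed.

Section Morphism.
Variable f : {linear KG -> KG}.
Hypothesis f_hprod : forall v, f (hprod v) = vprod v.

Lemma f_Sigma : maps_into (@Sigma gT K) f.
Proof.
apply: (Sigma_ind (subspace_preim f Sigma_subspace)) => v.
by rewrite f_hprod; apply: Sigma_vprod.
Qed.

Lemma f_one : f (KGone K gT) = KGone K gT.
Proof. by rewrite -{1}(block_sum_nil (@incK K gT)) -/(hprod _) f_hprod vprod_nil.
  Qed.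

Lemma f_mul x y : Sigma x -> Sigma y -> f (KGmul x y) = KGmul (f x) (f y).
Proof.
move=> xS yS.
apply: (Sigma_ind (subspace_ker (f \o KGmulr y) (KGmulr (f y) \o f)) _ xS) => v.
apply: (Sigma_ind (subspace_ker (f \o KGmul (hprod v)) (KGmul (f (hprod v)) \o
  f)) _ yS) => v'.
by rewrite /= -hprod_cat !f_hprod vprod_cat.
Qed.

Lemma coprod_hprod v :
  coprod (hprod v) = \sum_(p <- splits v) tensor (hprod p.1) (hprod p.2).
Proof. exact: (coprod_block_sum (@incK_inv K gT) (@incK_char K gT)). Qed.

Lemma coprod_vprod v :
  coprod (vprod v) = \sum_(p <- splits v) tensor (vprod p.1) (vprod p.2).
Proof. exact: (coprod_block_sum (@veeK_inv K gT) (@veeK_char K gT)). Qed.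

(** The elements hprod v and vprod v have coproducts of the same form. *)
Lemma f_coprod x : Sigma x -> coprod (f x) = tensor_map f f (coprod x).
Proof.
move: x; apply: (Sigma_ind (subspace_ker (@coprod K gT \o f) (tensor_map f f \o
  @coprod K gT))) => v.
rewrite /= f_hprod coprod_vprod coprod_hprod linear_sum; apply: eq_bigr => p _.
by rewrite /= tensor_mapE !f_hprod.
Qed.

Lemma f_counit x : Sigma x -> counit (f x) = counit x.
Proof.
move: x; apply: (Sigma_ind (subspace_ker ((@counit K gT : KG ->
  K^o) \o f) (@counit K gT : KG -> K^o))) => v.
by rewrite /= f_hprod !counit_block_sum //; [apply: incK_char | apply: veeK_char].
Qed.

Lemma triangle_sum (V : nmodType) (H : nat -> nat -> nat -> V) n :
  \sum_(i < n.+1) \sum_(j < i.+1) H j (i - j)%N (n - i)%N =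
  \sum_(i < n.+1) \sum_(j < (n - i).+1) H i j (n - i - j)%N.
Proof.
under eq_bigr => i _ do
  rewrite (big_ord_widen n.+1 (fun j => H j (i - j)%N (n - i)%N)) //.
rewrite (exchange_big_dep xpredT) //=; apply: eq_bigr => j _.
rewrite -(big_geq_mkord j n.+1 xpredT (fun i => H j (i - j)%N (n - i)%N)).
rewrite -[X in \sum_(X <= _ < _) _]add0n big_addn big_mkord subSn -1?ltnS //.
apply: eq_bigr => k _; congr H; lia.
Qed.

(** Coassociativity on products of generators: both sides sum over the ways to
    split each block size in three. *)
Lemma splits_assoc (V : nmodType) (F : _ -> _ -> _ -> V) v :
  \sum_(p <- @splits gT v) \sum_(q <- splits p.1) F q.1 q.2 p.2 =
  \sum_(p <- splits v) \sum_(q <- splits p.2) F p.1 q.1 q.2.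
Proof.
elim: v F => [|[n g] v IHv] F; first by rewrite !big_seq1.
rewrite (big_splits_cons (fun v1 v2 => \sum_(q <- splits v1) F q.1 q.2 v2)).
rewrite (big_splits_cons (fun v1 v2 => \sum_(q <- splits v2) F v1 q.1 q.2)).
under eq_bigr => i _ do under eq_bigr => p _ do
  rewrite (big_splits_cons (fun a b => F a b _)).
under [RHS]eq_bigr => i _ do under eq_bigr => p _ do
  rewrite (big_splits_cons (fun a b => F _ a b)).
under eq_bigr => i _ do rewrite exchange_big /=.
under [RHS]eq_bigr => i _ do rewrite exchange_big /=.
under eq_bigr => i _ do under eq_bigr => j _ do
  rewrite (IHv (fun a b c =>
    F ((j : nat, g) :: a) (((i - j)%N, g) :: b) (((n - i)%N, g) :: c))).
pose H i j k := \sum_(p <- splits v) \sum_(q <- splits p.2)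
   F ((i, g) :: p.1) ((j, g) :: q.1) ((k, g) :: q.2).
rewrite -[LHS]/(\sum_(i < n.+1) \sum_(j < i.+1) H j (i - j)%N (n - i)%N).
rewrite -[RHS]/(\sum_(i < n.+1) \sum_(j < (n - i).+1) H i j (n - i - j)%N).
exact: triangle_sum.
Qed.

Lemma splits_counitr (V : lmodType K) (F : _ -> V) v :
  \sum_(p <- @splits gT v) (weight p.2 == 0%N)%:R *: F p.1 = F v.
Proof.
elim: v F => [|[n g] v IHv] F; first by rewrite big_seq1 scale1r.
rewrite (big_splits_cons (fun v1 v2 => (weight v2 == 0%N)%:R *: F v1)).
rewrite big_ord_recr /= big1 ?add0r => [|i _]; last first.
  rewrite big1 // => p _.
  have lt := ltn_ord i; rewrite /= in lt.
  have /negbTE-> : weight ((n - i, g) :: p.2)%N != 0%N by rewrite weight_cons; lia.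
  by rewrite scale0r.
under eq_bigr => p _ do rewrite subnn.
exact: (IHv (fun u => F ((n, g) :: u))).
Qed.

Lemma splits_counitl (V : lmodType K) (F : _ -> V) v :
  \sum_(p <- @splits gT v) (weight p.1 == 0%N)%:R *: F p.2 = F v.
Proof.
elim: v F => [|[n g] v IHv] F; first by rewrite big_seq1 scale1r.
rewrite (big_splits_cons (fun v1 v2 => (weight v1 == 0%N)%:R *: F v2)).
rewrite big_ord_recl /= [X in _ + X]big1 ?addr0 => [|i _]; last first.
  by rewrite big1 // => p _; rewrite scale0r.
under eq_bigr => p _ do rewrite subn0.
exact: (IHv (fun u => F ((n, g) :: u))).
Qed.

Lemma Sigma_mulA x y z : Sigma x -> Sigma y -> Sigma z ->
  KGmul x (KGmul y z) = KGmul (KGmul x y) z.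
Proof.
move=> xS yS zS.
apply: (Sigma_ind (subspace_ker (KGmulr (KGmul y z)) (KGmulr z \o KGmulr y)) _
  xS) => v1.
apply: (Sigma_ind (subspace_ker (KGmul (hprod v1) \o KGmulr z)
                                (KGmulr z \o KGmul (hprod v1))) _ yS) => v2.
apply: (Sigma_ind (subspace_ker (KGmul (hprod v1) \o KGmul (hprod v2))
                                (KGmul (KGmul (hprod v1) (hprod v2)))) _ zS) => v3.
by rewrite /= -!hprod_cat catA.
Qed.

Lemma Sigma_mul1r x : Sigma x -> KGmul (KGone K gT) x = x.
Proof.
move: x; apply: (Sigma_ind (subspace_ker (KGmul (KGone K gT)) idfun)) => v.
by rewrite /= -(block_sum_nil (@incK K gT)) -/(hprod [::]) -hprod_cat.
Qed.

Lemma Sigma_mulr1 x : Sigma x -> KGmul x (KGone K gT) = x.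
Proof.
move: x; apply: (Sigma_ind (subspace_ker (KGmulr (KGone K gT)) idfun)) => v.
by rewrite /= /KGmulr -(block_sum_nil (@incK K gT)) -/(hprod [::]) -hprod_cat cats0.
Qed.

Lemma convolution_sum (f1 f2 : {linear KG ->
  KG}) (I : Type) (r : seq I) (A B : I -> KG) :
  mul_tensor (tensor_map f1 f2 (\sum_(p <- r) tensor (A p) (B p))) =
  \sum_(p <- r) KGmul (f1 (A p)) (f2 (B p)).
Proof.
rewrite (linear_sum (tensor_map f1 f2)) (linear_sum (@mul_tensor K gT)).
by apply: eq_bigr => p _; rewrite /= tensor_mapE.
Qed.

(** Both f o S and S o f are convolution inverses of f, the first because f is
    an algebra map and the second because it is a coalgebra map; the inverse is
    unique by coassociativity. *)
Lemma f_antipode S : antipode_on (@Sigma gT K) S ->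
  forall x, Sigma x -> f (S x) = S (f x).
Proof.
case=> SS SP; apply: (Sigma_ind (subspace_ker (f \o S) (S \o f))) => v /=.
have fS v' : Sigma (f (hprod v')) by rewrite f_hprod; apply: Sigma_vprod.
have SSh v' : Sigma (S (hprod v')) by apply/SS/Sigma_hprod.
(* f o S is a left inverse of f. *)
have left_inv v' : \sum_(p <- splits v') KGmul (f (S (hprod p.1))) (f (hprod p.2)) =
    (weight v' == 0%N)%:R *: KGone K gT.
  have [/(congr1 f) + _] := SP _ (Sigma_hprod K v').
  rewrite coprod_hprod counit_block_sum; last exact: incK_char.
  rewrite linearZ /= f_one (convolution_sum S idfun) => <-; rewrite linear_sum.
  by apply: eq_bigr => p _; rewrite /= f_mul //; apply: Sigma_hprod.
(* S o f is a right inverse of f. *)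
have right_inv v' :
  \sum_(p <- splits v') KGmul (f (hprod p.1)) (S (f (hprod p.2))) =
    (weight v' == 0%N)%:R *: KGone K gT.
  have [_] := SP _ (Sigma_vprod v').
  rewrite coprod_vprod counit_block_sum; last exact: veeK_char.
  rewrite (convolution_sum idfun S) => <-.
  by apply: eq_bigr => p _; rewrite !f_hprod.
rewrite -[f (S (hprod v))](splits_counitr (fun v' => f (S (hprod v')))).
rewrite -[RHS](splits_counitl (fun v' => S (f (hprod v')))).
pose A p := f (S (hprod p)); pose B p := f (hprod p); pose C p := S (f (hprod p)).
have AS p : Sigma (A p) by apply/f_Sigma/SSh.
have BS p : Sigma (B p) by apply: fS.
have CS p : Sigma (C p) by apply/SS/fS.
transitivity (\sum_(p <- splits v) \sum_(q <- splits p.2)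
  KGmul (A p.1) (KGmul (B q.1) (C q.2))).
  apply: eq_bigr => p _; rewrite -(linear_sum (KGmul (A p.1))) right_inv.
  by rewrite linearZ /= Sigma_mulr1.
rewrite -(splits_assoc (fun a b c => KGmul (A a) (KGmul (B b) (C c)))).
apply: eq_bigr => p _.
rewrite (eq_bigr (fun q => KGmul (KGmul (A q.1) (B q.2)) (C p.2))) => [|q _].
  by rewrite -KGmul_suml left_inv KGmulZl Sigma_mul1r.
by rewrite Sigma_mulA.
Qed.
End Morphism.
End HopfMorphism.

(** * The image of Theta *)

Section Image.
Variables (K : fieldType) (gT : finGroupType).
Hypothesis charK : [pchar K] =i pred0.
Local Notation word := (seq (nat * gT)).
Local Notation KG := (KG K gT).
Local Notation cw := (@coloured_word gT _).
Local Notation vprod := (@vprod K gT).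
Implicit Types (x y : KG) (v c : seq (nat * gT)) (g : gT).

Lemma veeK_class v (a b : wreath gT (weight v)) :
  runs false (cw a) = runs false (cw b) ->
  block_coef (@veeK K gT) v (cw a) = block_coef (@veeK K gT) v (cw b).
Proof.
move/runs_full_flags => E.
rewrite !(@block_coef_veeK _ _ v _ (full_flags false (cw a))) ?size_cw ?uniq_cw //.
by rewrite E.
Qed.

Lemma Peaks_vprod v : Peaks (vprod v).
Proof.
apply: (@in_span_ext _ _ (class_sum K false)) => [c|]; first by rewrite pGE.
exact/word_sum_in_span/veeK_class.
Qed.

Variable P : KG -> Prop.
Hypothesis PS : subspace P.
Hypothesis P_vprod : forall v, P (vprod v).

(** By induction on the weight of the peak composition c0.  The product
    vprod c0 contains the class of c0 with a nonzero coefficient, and all other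
    classes in it have smaller weight. *)
Lemma class_sum_peaks n (a0 : wreath gT n) :
  P (class_sum K false (runs false (cw a0))).
Proof.
have [m] := ubnP (tail_weight (unzip1 (full_flags false (cw a0)))).
elim: m a0 => // m IHm a0; rewrite ltnS => le_m.
set c0 := runs false (cw a0).
have wc0 : weight c0 = n by rewrite weight_runs size_cw.
pose kappa c := block_coef (@veeK K gT) c0 (cw (class_rep false n c)).
have yE : vprod c0 =
  \sum_(c <- class_list gT false n) kappa c *: class_sum K false c.
  rewrite /vprod /block_sum wc0 (@word_sum_classes _ K false n) // => a b.
  by have := @veeK_class c0; rewrite wc0; apply.
have c0_in : c0 \in class_list gT false n.
  by rewrite mem_undup; apply: image_f.
rewrite (bigD1_seq c0) ?undup_uniq //= in yE.
have k0 : kappa c0 != 0.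
  rewrite /kappa (@block_coef_veeK _ _ _ _ (expand c0)) ?size_cw ?wc0 ?uniq_cw //.
    by apply: peak_coef_expand => //; apply: is_Gcomp_runs.
  by rewrite -[c0 in expand c0](class_listP c0_in) expand_runs.
have -> : class_sum K false c0 = (kappa c0)^-1 *: (vprod c0 -
    \sum_(c <- class_list gT false n | c != c0) kappa c *: class_sum K false c).
  by rewrite yE addrK scalerA mulVf ?scale1r.
apply: subspaceZ => //; apply: subspaceB => //.
rewrite (bigID (fun c => kappa c == 0)) /= big1 ?add0r; last first.
  by move=> c /andP[_ /eqP->]; rewrite scale0r.
apply: subspace_sum => // c c_in /andP[neq kc].
rewrite -(class_listP c_in); apply: IHm.
have sz : size (cw (class_rep false n c)) = size (cw a0) by rewrite !size_cw.
have [E|lt] := peak_coef_triangular (uniq_cw _) sz kc;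
  last exact: leq_trans lt le_m.
by case/eqP: neq; rewrite -(class_listP c_in) E.
Qed.

(** A composition that is not the peak composition of any word has an empty
    class, whose sum is 0. *)
Lemma Peaks_min y : Peaks y -> P y.
Proof.
move: y; apply: (in_span_ind PS) => c cG; rewrite pGE.
have [[a Ea]|none] := altP (@existsP _ (fun a : wreath gT (weight c) =>
  runs false (cw a) == c)).
  by rewrite -(eqP Ea); apply: class_sum_peaks.
rewrite /word_sum big1 => [|a _]; first exact: PS.1.
case: eqP => [E|]; last by rewrite scale0r.
by case/existsP: none; exists a; rewrite E.
Qed.

End Image.

Lemma hprod1 (K : fieldType) (gT : finGroupType) n (g : gT) : (0 < n)%N ->
  hprod K [:: (n, g)] = dG K [:: (n, g)].
Proof.
move=> n0; have := @hprod_mul_dG K gT n g [::] n0 isT.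
by rewrite addr0 dG_nil Sigma_mulr1 //; apply: Sigma_hprod.
Qed.

Theorem proposition5p1 (K : fieldType) (gT : finGroupType)
    (charK : [pchar K] =i pred0) (abG : abelian [set: gT]) :
  exists Theta : {linear KG K gT -> KG K gT},
    [/\ is_Theta Theta,
        forall Theta' : {linear KG K gT -> KG K gT}, is_Theta Theta' ->
          forall x, Sigma x -> Theta' x = Theta x,
        hopf_morphism_on (@Sigma gT K) Theta
      & forall y, (exists2 x, Sigma x & Theta x = y) <-> Peaks y].
Proof.
pose f : {linear KG K gT -> KG K gT} := @theta K gT.
have f_h v : f (hprod K v) = vprod K v by apply: theta_hprod.
have f_alg : algebra_map_on (@Sigma gT K) f.
  by split; [apply: f_one | apply: f_mul].
have f_gen (n : nat) (g : gT) : (0 < n)%N ->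
    f (dG K [:: (n, g)]) = 2 *: pG K [:: (n, g)].
  by move=> n0; rewrite -hprod1 // f_h pG_vprod.
exists f; split.
- by split=> //; apply: f_Sigma.
- move=> f' [_ [f'1 f'M] f'_gen].
  apply: (Sigma_ind (subspace_ker f' f)).
  elim=> [|[n g] v IHv]; first by rewrite /hprod block_sum_nil f'1 f_alg.1.
  case: n => [|n].
    by rewrite /hprod block_sum0 // => h; apply: (incK_char _ _).1.
  have E : f' (hprod K [:: (n.+1, g)]) = f (hprod K [:: (n.+1, g)]).
    by rewrite (@hprod1 K gT n.+1 g isT) (f'_gen n.+1 g isT) (f_gen n.+1 g isT).
  have Sh := @Sigma_hprod K gT.
  by rewrite -cat1s hprod_cat (f'M _ _ (Sh _) (Sh _)) (f_alg.2 _ _ (Sh _) (Sh _))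
    E IHv.
- split=> //; first exact: f_Sigma.
    by split; [apply: f_coprod | apply: f_counit].
  exact: f_antipode.
move=> y; split=> [[x xS <-]|].
  move: x xS; apply: (Sigma_ind (subspace_preim f (in_span_subspace _))) => v.
  by rewrite f_h; apply: Peaks_vprod.
have imS : subspace (fun y => exists2 x, Sigma x & f x = y).
  split=> [|a _ _ [x xS <-] [x' xS' <-]].
    by exists 0; [case: (Sigma_subspace K gT) | rewrite linear0].
  exists (a *: x + x'); last by rewrite linearP.
  by case: (Sigma_subspace K gT) => _; apply.
apply: (Peaks_min charK imS) => v.
by exists (hprod K v); [apply: Sigma_hprod | apply: f_h].
Qed.
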